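(* Let $\mathcal{A}$ be a coquasitriangular complex Hopf algebra with universal $r$-form $\mathbf{r}$, let $\mathbf{u}=(u^i_j)_{i,j=1,\dots,n}$ be an $n$-dimensional matrix corepresentation of $\mathcal{A}$ with $L$-functionals $l^{\pm i}_{\ \ j}$ and $R$-matrix $\hat R$. Assume: (a) $l^{-m}_{\ \ n}=0$ for $m<n$; (b) $(l^{-n}_{\ \ i},u^j_n)=0$ for $i\neq j$, $i,j=1,\dots,n$; (c) the number $\alpha:=((l^{-n}_{\ \ n})^2,u^n_n)-1$ is non-zero, and $(l^{-n}_{\ \ i}l^{-n}_{\ \ n},u^i_n)=\alpha$ for $i=1,\dots,n-1$. Let $\mathcal{X}$ be the unital subalgebra of $\mathcal{A}$ generated by $x_i:=u^i_n$, $i=1,\dots,n$. Let $\Gamma$ be the left-covariant first order differential calculus (FODC) on $\mathcal{A}$ whose quantum tangent space is the linear span of the functionals $$X_i:=\alpha^{-1}\,l^{-n}_{\ \ i}\,l^{-n}_{\ \ n}\ (i=1,\dots,n-1),\qquad X_n:=\alpha^{-1}\big((l^{-n}_{\ \ n})^2-\varepsilon\big).$$ Let $\mathrm{d}$ be the differentiation of $\Gamma$, let $\Gamma^{\mathcal X}:=\mathcal{X}\cdot\mathrm{d}\mathcal{X}\cdot\mathcal{X}\subseteq\Gamma$ be the FODC on $\mathcal{X}$ induced by $\Gamma$, and let $\theta_n:=\omega(u^n_n)=\sum_k S(u^n_k)\,\mathrm{d}u^k_n\in\Gamma$. Then: (i) $\Gamma^{\mathcal X}$ is a left-covariant FODC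 of $\mathcal{X}$ such that $\{\mathrm{d}x_1,\dots,\mathrm{d}x_n\}$ is a free left $\mathcal{X}$-module basis of $\Gamma^{\mathcal X}$. The $\mathcal{X}$-bimodule structure of $\Gamma^{\mathcal X}$ is determined by the commutation relations $$\mathrm{d}x_i\cdot x_j=(l^{-n}_{\ \ n},u^n_n)\sum_{k,m=1}^n(\hat R^{-1})^{ij}_{km}\,x_k\cdot\mathrm{d}x_m,\qquad i,j=1,\dots,n,$$ or equivalently by $$\mathrm{d}x_i\cdot x=\sum_{m=1}^n\bar{\mathbf r}(u^i_m,x_{(1)})\,x_{(2)}\,(l^{-n}_{\ \ n},x_{(3)})\,\mathrm{d}x_m,\qquad x\in\mathcal{X},\ i=1,\dots,n.$$ (ii) In $\Gamma$ we have $$\mathrm{d}x=\alpha^{-1}(\theta_n x-x\theta_n)\qquad\text{for all }x\in\mathcal{X}.$$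
   Context: Hopf algebra notation: $\Delta,\varepsilon,S$ are comultiplication, counit, antipode; Sweedler notation $\Delta(a)=a_{(1)}\otimes a_{(2)}$. $\mathcal{A}^\circ$ is the Hopf dual, with product $(fg)(a)=f(a_{(1)})g(a_{(2)})$, unit $\varepsilon$ and antipode $S(f)(a)=f(S(a))$; $(f,a):=f(a)$ for $f\in\mathcal{A}^\circ$, $a\in\mathcal{A}$. Coquasitriangular: $\mathcal{A}$ is equipped with a convolution-invertible linear functional $\mathbf r$ on $\mathcal{A}\otimes\mathcal{A}$ (universal $r$-form; write $\mathbf r(a,b)=\mathbf r(a\otimes b)$), with convolution inverse $\bar{\mathbf r}$, such that for all $a,b,c\in\mathcal{A}$: $\mathbf r(ab,c)=\mathbf r(a,c_{(1)})\mathbf r(b,c_{(2)})$, $\mathbf r(a,bc)=\mathbf r(a_{(1)},c)\mathbf r(a_{(2)},b)$, $\mathbf r(a_{(1)},b_{(1)})a_{(2)}b_{(2)}=\mathbf r(a_{(2)},b_{(2)})b_{(1)}a_{(1)}$. Matrix corepresentation: $u^i_j\in\mathcal{A}$ with $\Delta(u^i_j)=\sum_k u^i_k\otimes u^k_j$, $\varepsilon(u^i_j)=\delta_{ij}$. $L$-functionals: $l^{+i}_{\ \ j}(a)=\mathbf r(a,u^i_j)$, $l^{-i}_{\ \ j}(a)=\bar{\mathbf r}(u^i_j,a)$; they lie in $\mathcal{A}^\circ$. $R$-matrix: $\hat R^{ji}_{nm}:=\mathbf r(u^i_n,u^j_m)$, so that $(\hat R^{-1})^{ik}_{lj}=\bar{\mathbf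 r}(u^i_j,u^k_l)$. A first order differential calculus (FODC) over an algebra $\mathcal{X}$ is an $\mathcal{X}$-bimodule $\Gamma$ with a linear map $\mathrm{d}:\mathcal{X}\to\Gamma$ such that $\mathrm{d}(xy)=x\cdot\mathrm{d}y+\mathrm{d}x\cdot y$ and $\Gamma$ is the linear span of elements $x\cdot\mathrm{d}y\cdot z$, $x,y,z\in\mathcal X$. If $\mathcal{X}\subseteq\mathcal{A}$ is a subalgebra with $\Delta(\mathcal{X})\subseteq\mathcal{A}\otimes\mathcal{X}$ (e.g. $\mathcal X=\mathcal A$), a FODC $\Gamma$ over $\mathcal{X}$ is left-covariant if there is a linear map $\Phi:\Gamma\to\mathcal{A}\otimes\Gamma$ with $\Phi(x\,\mathrm{d}y)=\Delta(x)(\mathrm{id}\otimes\mathrm{d})\Delta(y)$ for $x,y\in\mathcal{X}$; elements $\eta$ with $\Phi(\eta)=1\otimes\eta$ are left-invariant. For a left-covariant FODC $\Gamma$ over $\mathcal{A}$ put $\omega(a):=S(a_{(1)})\,\mathrm{d}a_{(2)}$ for $a\in\mathcal A$. If the space of left-invariant one-forms is finite-dimensional, the quantum tangent space of $\Gamma$ is the space of linear functionals $X$ on $\mathcal{A}$ with $X(1)=0$ and $X(a)=0$ whenever $\varepsilon(a)=0$ and $\omega(a)=0$. It is a finite-dimensional subspace of $\mathcal{A}^\circ$ and determines $\Gamma$ up to isomorphism. A finite-dimensional subspace $\mathcal{T}\subseteq\mathcal{A}^\circ$ is the quantum tangent space of a left-covariant FODC over $\mathcal{A}$ if and only if $X(1)=0$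 and $\Delta(X)-\varepsilon\otimes X\in\mathcal{T}\otimes\mathcal{A}^\circ$ for all $X\in\mathcal{T}$; under the stated assumptions this holds for the span of $X_1,\dots,X_n$. *)

(* Defs.v *)
From HB Require Import structures.
From mathcomp Require Import all_boot all_order all_algebra generic_quotient.
From mathcomp Require Import boolp classical_sets functions.

Set Implicit Arguments.
Unset Strict Implicit.
Unset Printing Implicit Defensive.
Import GRing.Theory.
Local Open Scope classical_set_scope.
Local Open Scope ring_scope.
Local Open Scope quotient_scope.

Reserved Notation "v ⊗ w" (at level 40, left associativity).
Reserved Notation "\sw_ ( x , y <- t ) F"
  (at level 41, x binder, y binder, t at level 99, F at level 41,
   right associativity, format "\sw_ ( x ,  y  <-  t )  F").

(* The tensor product of two K-vector spaces is the quotient of the formal   *)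
(* sums of pairs, encoded as lists, that identifies two sums on which all     *)
(* bilinear maps agree. Its universal property is tliftE, tlift_is_linear and *)
(* tensor_ind below.                                                          *)
Section Tensor.
Variables (K : fieldType) (V W : lmodType K).
Implicit Types (s t : seq (V * W)).

Definition tens_eval (U : nmodType) (b : V -> W -> U) s : U :=
  \sum_(p <- s) b p.1 p.2.

Definition tens_rel s t : bool :=
  `[< forall (U : lmodType K) (b : {bilinear V -> W -> U}),
        tens_eval b s = tens_eval b t >].

Lemma tens_rel_refl : reflexive tens_rel.
Proof. by move=> s; apply/asboolP. Qed.

Lemma tens_rel_sym : symmetric tens_rel.
Proof.
by move=> s t; apply/asboolP/asboolP => h U b; rewrite h.
Qed.

Lemma tens_rel_trans : transitive tens_rel.
Proof.
by move=> s t w /asboolP h1 /asboolP h2; apply/asboolP => U b; rewrite h1 h2.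
Qed.

Canonical tens_equiv := EquivRel tens_rel
  tens_rel_refl tens_rel_sym tens_rel_trans.

Definition tensor := {eq_quot tens_equiv}.
HB.instance Definition _ := Choice.on tensor.
HB.instance Definition _ := EqQuotient.on tensor.

Definition tpure (v : V) (w : W) : tensor := \pi_tensor [:: (v, w)].

(* The value of tlift does not depend on the chosen representative only when  *)
(* b is bilinear.                                                             *)
Definition tlift (U : nmodType) (b : V -> W -> U) (t : tensor) : U :=
  tens_eval b (repr t).

Lemma tlift_pi (U : lmodType K) (b : {bilinear V -> W -> U}) s :
  tlift b (\pi_tensor s) = tens_eval b s.
Proof.
rewrite /tlift.
have /eqP : \pi_tensor (repr (\pi_tensor s)) = \pi_tensor s by rewrite reprK.
by rewrite eqmodE => /asboolP ->.
Qed.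

Lemma tensor_ext (x y : tensor) :
  (forall (U : lmodType K) (b : {bilinear V -> W -> U}),
     tlift b x = tlift b y) -> x = y.
Proof.
move=> h; rewrite -[x]reprK -[y]reprK; apply/eqP.
by rewrite eqmodE; apply/asboolP => U b; apply: h.
Qed.

Definition tadd (x y : tensor) : tensor := \pi_tensor (repr x ++ repr y).
Definition tzero : tensor := \pi_tensor [::].
Definition tscale (a : K) (x : tensor) : tensor :=
  \pi_tensor [seq (a *: p.1, p.2) | p <- repr x].
Definition topp (x : tensor) : tensor := tscale (-1) x.

Lemma tlift_tadd (U : lmodType K) (b : {bilinear V -> W -> U}) x y :
  tlift b (tadd x y) = tlift b x + tlift b y.
Proof. by rewrite tlift_pi /tens_eval big_cat. Qed.

Lemma tlift_tzero (U : lmodType K) (b : {bilinear V -> W -> U}) :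
  tlift b tzero = 0.
Proof. by rewrite tlift_pi /tens_eval big_nil. Qed.

Lemma tlift_tscale (U : lmodType K) (b : {bilinear V -> W -> U}) a x :
  tlift b (tscale a x) = a *: tlift b x.
Proof.
rewrite tlift_pi /tens_eval big_map scaler_sumr; apply: eq_bigr => p _ /=.
by rewrite linearZl_LR.
Qed.

Lemma taddA : associative tadd.
Proof. by move=> x y z; apply: tensor_ext => U b; rewrite !tlift_tadd addrA. Qed.
Lemma taddC : commutative tadd.
Proof. by move=> x y; apply: tensor_ext => U b; rewrite !tlift_tadd addrC. Qed.
Lemma tadd0 : left_id tzero tadd.
Proof.
by move=> x; apply: tensor_ext => U b; rewrite tlift_tadd tlift_tzero add0r.
Qed.
Lemma taddN : left_inverse tzero topp tadd.
Proof.
move=> x; apply: tensor_ext => U b.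
by rewrite tlift_tadd tlift_tscale tlift_tzero scaleN1r addNr.
Qed.
HB.instance Definition _ :=
  GRing.isZmodule.Build tensor taddA taddC tadd0 taddN.

Lemma tscaleA a b x : tscale a (tscale b x) = tscale (a * b) x.
Proof. by apply: tensor_ext => U f; rewrite !tlift_tscale scalerA. Qed.
Lemma tscale1 : left_id 1 tscale.
Proof. by move=> x; apply: tensor_ext => U f; rewrite tlift_tscale scale1r. Qed.
Lemma tscaleDr : right_distributive tscale +%R.
Proof.
move=> a x y; apply: tensor_ext => U f.
by rewrite !(tlift_tscale, tlift_tadd) scalerDr.
Qed.
Lemma tscaleDl x : {morph tscale^~ x : a b / a + b}.
Proof.
move=> a b; apply: tensor_ext => U f.
by rewrite !(tlift_tscale, tlift_tadd) scalerDl.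
Qed.
HB.instance Definition _ := GRing.Zmodule_isLmodule.Build K tensor
  tscaleA tscale1 tscaleDr tscaleDl.

Lemma tliftE (U : lmodType K) (b : {bilinear V -> W -> U}) v w :
  tlift b (tpure v w) = b v w.
Proof. by rewrite tlift_pi /tens_eval big_seq1. Qed.

Lemma tlift_is_linear (U : lmodType K) (b : {bilinear V -> W -> U}) :
  linear (tlift b).
Proof. by move=> a x y; rewrite tlift_tadd tlift_tscale. Qed.

Lemma tpure_is_bilinear : bilinear_for *:%R *:%R tpure.
Proof.
split=> [w a v v'|v a w w']; apply: tensor_ext => U b.
  by rewrite tlift_is_linear !tliftE linearPl.
by rewrite tlift_is_linear !tliftE linearPr.
Qed.
HB.instance Definition _ := bilinear_isBilinear.Build K V W tensor
  *:%R *:%R tpure tpure_is_bilinear.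

Lemma tensor_ind (P : tensor -> Prop) :
  P 0 -> (forall v w x, P x -> P (tpure v w + x)) -> forall x, P x.
Proof.
move=> P0 PD x; rewrite -[x]reprK; elim: (repr x) => [|[v w] s IHs].
  exact: P0.
suff -> : \pi_tensor ((v, w) :: s) = tpure v w + \pi_tensor s by apply: PD.
apply: tensor_ext => U b.
by rewrite tlift_tadd !tlift_pi /tens_eval big_cons big_seq1.
Qed.

End Tensor.

Notation "v ⊗ w" := (tpure v w) : ring_scope.
Notation "\sw_ ( x , y <- t ) F" := (tlift (fun x y => F) t) : ring_scope.

Section TensorMaps.
Variable K : fieldType.

Definition tmap (V V' W W' : lmodType K) (f : V -> V') (g : W -> W')
    (t : tensor V W) : tensor V' W' :=
  \sw_(v, w <- t) f v ⊗ g w.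

Definition tassoc (U V W : lmodType K) (t : tensor (tensor U V) W)
  : tensor U (tensor V W) :=
  \sw_(s, w <- t) \sw_(u, v <- s) u ⊗ (v ⊗ w).

Definition tmul (A B : algType K) (s t : tensor A B) : tensor A B :=
  \sw_(a, b <- s) \sw_(a', b' <- t) (a * a') ⊗ (b * b').

End TensorMaps.

HB.mixin Record isHopfAlgebra (K : fieldType) A of GRing.Algebra K A := {
  comul : {linear A -> tensor A A};
  counit : {scalar A};
  antipode : {linear A -> A};
  comul1 : comul 1 = 1 ⊗ 1;
  comulM : forall a b : A, comul (a * b) = tmul (comul a) (comul b);
  counit1 : counit 1 = 1;
  counitM : forall a b : A, counit (a * b) = counit a * counit b;
  comulA : forall a : A,
    tassoc (tmap comul idfun (comul a)) = tmap idfun comul (comul a);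
  counitl : forall a : A, \sw_(x, y <- comul a) counit x *: y = a;
  counitr : forall a : A, \sw_(x, y <- comul a) counit y *: x = a;
  antipodel : forall a : A,
    \sw_(x, y <- comul a) antipode x * y = counit a *: 1;
  antipoder : forall a : A,
    \sw_(x, y <- comul a) x * antipode y = counit a *: 1
}.

#[short(type="hopfAlgType")]
HB.structure Definition HopfAlgebra (K : fieldType) :=
  {A of isHopfAlgebra K A & GRing.Algebra K A}.

Section Coquasitriangular.
Variables (K : fieldType) (A : hopfAlgType K).

(* The product of the dual algebra. *)
Definition conv (f g : A -> K^o) : A -> K^o :=
  fun a => \sw_(x, y <- comul a) f x * g y.

Record universal_r_form := UniversalRForm {
  rform : {scalar tensor A A};
  rform_inv : {scalar tensor A A};
  rform_convr : forall a b : A,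
    \sw_(a1, a2 <- comul a) \sw_(b1, b2 <- comul b)
      rform (a1 ⊗ b1) * rform_inv (a2 ⊗ b2) = counit a * counit b;
  rform_convl : forall a b : A,
    \sw_(a1, a2 <- comul a) \sw_(b1, b2 <- comul b)
      rform_inv (a1 ⊗ b1) * rform (a2 ⊗ b2) = counit a * counit b;
  rformMl : forall a b c : A, rform ((a * b) ⊗ c) =
    \sw_(c1, c2 <- comul c) rform (a ⊗ c1) * rform (b ⊗ c2);
  rformMr : forall a b c : A, rform (a ⊗ (b * c)) =
    \sw_(a1, a2 <- comul a) rform (a1 ⊗ c) * rform (a2 ⊗ b);
  rform_comm : forall a b : A,
    \sw_(a1, a2 <- comul a) \sw_(b1, b2 <- comul b)
      rform (a1 ⊗ b1) *: (a2 * b2) =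
    \sw_(a1, a2 <- comul a) \sw_(b1, b2 <- comul b)
      rform (a2 ⊗ b2) *: (b1 * a1)
}.

Definition matrix_corepresentation n (u : 'M[A]_n) : Prop :=
  (forall i j, comul (u i j) = \sum_k u i k ⊗ u k j) /\
  (forall i j, counit (u i j) = (i == j)%:R :> K).

Definition Lminus (r : universal_r_form) n (u : 'M[A]_n) (i j : 'I_n)
  : A -> K^o := fun a => rform_inv r (u i j ⊗ a).

(* Rows and columns are indexed by pairs through enum_val: the upper indices  *)
(* (j, i) give the row and the lower indices (k, l) the column.               *)
Definition Rhat (r : universal_r_form) n (u : 'M[A]_n)
  : 'M[K]_#|{: 'I_n * 'I_n}| :=
  \matrix_(p, q) let: (j, i) := enum_val p in let: (k, l) := enum_val q in
    rform r (u i k ⊗ u j l).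

Definition Rhat_inv (r : universal_r_form) n (u : 'M[A]_n)
    (i j k m : 'I_n) : K :=
  invmx (Rhat r u) (enum_rank (i, j)) (enum_rank (k, m)).

End Coquasitriangular.

Section Span.
Variables (K : fieldType) (V : lmodType K).

Definition linear_span (S : set V) : set V :=
  [set v | exists2 s : seq (K * V), (forall p, p \in s -> S p.2) &
             v = \sum_(p <- s) p.1 *: p.2].

Definition finite_dimensional (S : set V) : Prop :=
  exists s : seq V, S `<=` linear_span [set` s].

Lemma linear_span_sub S : S `<=` linear_span S.
Proof.
move=> v Sv; exists [:: (1, v)]; last by rewrite big_seq1 scale1r.
by move=> p; rewrite inE => /eqP ->.
Qed.

Lemma linear_span0 S : linear_span S 0.
Proof. by exists [::]; rewrite ?big_nil. Qed.

Lemma linear_spanP S a v w :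
  linear_span S v -> linear_span S w -> linear_span S (a *: v + w).
Proof.
move=> [s Ss ->] [t St ->].
exists ([seq (a * p.1, p.2) | p <- s] ++ t).
  move=> p; rewrite mem_cat => /orP[/mapP[q qs ->]|]; last exact: St.
  exact: (Ss _ qs).
rewrite big_cat big_map scaler_sumr; congr (_ + _).
by apply: eq_bigr => p _; rewrite scalerA.
Qed.

Lemma linear_span_ind S (P : V -> Prop) :
  P 0 -> (forall a v w, S v -> P w -> P (a *: v + w)) ->
  forall v, linear_span S v -> P v.
Proof.
move=> P0 PD v [s]; elim: s v => [|p s IHs] v Ss ->; first by rewrite big_nil.
rewrite big_cons; apply: PD; first by apply: Ss; rewrite mem_head.
by apply: IHs => // q qs; apply: Ss; rewrite in_cons qs orbT.
Qed.

Definition span_pred (S : set V) : {pred V} := fun v => `[< linear_span S v >].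

Lemma span_pred_submod S : submod_closed (span_pred S).
Proof.
split=> [|a v w /asboolP hv /asboolP hw]; apply/asboolP.
  exact: linear_span0.
exact: linear_spanP.
Qed.
HB.instance Definition _ (S : set V) :=
  GRing.isSubmodClosed.Build K V (span_pred S)
    (GRing.submod_closed_semi (span_pred_submod S)).

Definition span_type (S : set V) := {v : V | v \in span_pred S}.
HB.instance Definition _ (S : set V) := SubChoice.on (span_type S).
HB.instance Definition _ (S : set V) :=
  [SubChoice_isSubLmodule of span_type S by <:].

End Span.

Section GeneratedSubalgebra.
Variables (K : fieldType) (A : algType K).

Definition subalg_pred (S : set A) : {pred A} :=
  fun a => `[< forall B : {pred A},
    subalg_closed B -> (forall s, S s -> s \in B) -> a \in B >].

Lemma subalg_pred_closed S : subalg_closed (subalg_pred S).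
Proof.
split=> [|a x y /asboolP hx /asboolP hy|x y /asboolP hx /asboolP hy];
  apply/asboolP => B cB sB; case: (cB) => B1 BP BM //.
- by apply: BP; [apply: hx|apply: hy].
- by apply: BM; [apply: hx|apply: hy].
Qed.
HB.instance Definition _ (S : set A) :=
  GRing.isSubalgClosed.Build K A (subalg_pred S)
    (GRing.subalg_closed_semi (subalg_pred_closed S)).

Definition subalg_type (S : set A) := {a : A | a \in subalg_pred S}.
HB.instance Definition _ (S : set A) := SubChoice.on (subalg_type S).
HB.instance Definition _ (S : set A) :=
  [SubChoice_isSubAlgebra of subalg_type S by <:].

Definition subalg_incl (S : set A) : subalg_type S -> A := \val.

Lemma subalg_incl_linear S : linear (@subalg_incl S).
Proof. by move=> a x y; rewrite /subalg_incl linearP. Qed.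

Lemma subalg_incl_monoid S : monoid_morphism (@subalg_incl S).
Proof. by split=> [|x y]; rewrite /subalg_incl ?rmorph1 ?rmorphM. Qed.
HB.instance Definition _ (S : set A) := GRing.isLinear.Build K (subalg_type S) A
  *:%R (@subalg_incl S) (@subalg_incl_linear S).
HB.instance Definition _ (S : set A) := GRing.isMonoidMorphism.Build
  (subalg_type S) A (@subalg_incl S) (@subalg_incl_monoid S).

Lemma mem_subalg (S : set A) s : S s -> s \in subalg_pred S.
Proof. by move=> Ss; apply/asboolP => B _; apply. Qed.

End GeneratedSubalgebra.

Section Calculus.
Variables (K : fieldType) (X : algType K).

Definition is_bimodule (G : lmodType K)
    (l : X -> G -> G) (r : G -> X -> G) : Prop :=
  [/\ forall g, l 1 g = g,
      forall x y g, l (x * y) g = l x (l y g),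
      forall g, r g 1 = g,
      forall g x y, r g (x * y) = r (r g x) y &
      forall x g y, l x (r g y) = r (l x g) y].

Record fodc := Fodc {
  forms :> lmodType K;
  lact : {bilinear X -> forms -> forms};
  ract : {bilinear forms -> X -> forms};
  diff : {linear X -> forms};
  fodc_bimodule : is_bimodule lact ract;
  diffM : forall x y, diff (x * y) = lact x (diff y) + ract (diff x) y;
  forms_span : forall g, linear_span
    [set h | exists x y z, h = lact x (ract (diff y) z)] g
}.

Definition free_left_basis (G : fodc) (I : finType) (e : I -> G) : Prop :=
  forall g : G, exists! c : {ffun I -> X}, g = \sum_i lact G (c i) (e i).

End Calculus.

Section Covariance.
Variables (K : fieldType) (A : hopfAlgType K).

(* The left action of the algebra A (x) X on A (x) G. *)
Definition tact (X : algType K) (G : fodc X)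
    (s : tensor A X) (t : tensor A G) : tensor A G :=
  \sw_(a, x <- s) \sw_(b, g <- t) (a * b) ⊗ lact G x g.

(* X is regarded as a subalgebra of A through the embedding iota. That        *)
(* comul maps X into A (x) X is the existence of delta, which is unique when  *)
(* iota is injective.                                                         *)
Definition left_coaction (X : algType K) (iota : X -> A) (G : fodc X)
    (Phi : {linear G -> tensor A G}) : Prop :=
  exists2 delta : {linear X -> tensor A X},
    forall x, tmap idfun iota (delta x) = comul (iota x) &
    forall x y, Phi (lact G x (diff G y)) =
                tact (delta x) (tmap idfun (diff G) (delta y)).

Definition left_covariant (X : algType K) (iota : X -> A) (G : fodc X) : Prop :=
  exists Phi : {linear G -> tensor A G}, left_coaction iota Phi.

Definition left_invariant (G : fodc A) (Phi : {linear G -> tensor A G})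
  : set G := [set eta | Phi eta = 1 ⊗ eta].

Definition omega (G : fodc A) (a : A) : G :=
  \sw_(x, y <- comul a) lact G (antipode x) (diff G y).

Definition tangent_functionals (G : fodc A) : set (A -> K^o) :=
  [set f | [/\ scalar f, f 1 = 0 &
              forall a, counit a = 0 -> omega G a = 0 -> f a = 0]].

(* The quantum tangent space is only defined when the left-invariant forms    *)
(* are finite-dimensional.                                                    *)
Definition is_quantum_tangent_space (G : fodc A)
    (Phi : {linear G -> tensor A G}) (T : set (A -> K^o)) : Prop :=
  finite_dimensional (left_invariant Phi) /\ T = tangent_functionals G.

End Covariance.

Section InducedCalculus.
Variables (K : fieldType) (A X : algType K) (iota : {lrmorphism X -> A}).
Variable G : fodc A.

Definition induced_gen : set G :=
  [set h | exists x y z : X,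
     h = lact G (iota x) (ract G (diff G (iota y)) (iota z))].

Definition induced_forms : lmodType K := span_type induced_gen.

Let l1 (g : G) : lact G 1 g = g. Proof. have [h _ _ _ _] := fodc_bimodule G; exact: h. Qed.
Let lM (x y : A) (g : G) : lact G (x * y) g = lact G x (lact G y g).
Proof. have [_ h _ _ _] := fodc_bimodule G; exact: h. Qed.
Let r1 (g : G) : ract G g 1 = g. Proof. have [_ _ h _ _] := fodc_bimodule G; exact: h. Qed.
Let rM (g : G) (x y : A) : ract G g (x * y) = ract G (ract G g x) y.
Proof. have [_ _ _ h _] := fodc_bimodule G; exact: h. Qed.
Let lr (x : A) (g : G) (y : A) :
  lact G x (ract G g y) = ract G (lact G x g) y.
Proof. have [_ _ _ _ h] := fodc_bimodule G; exact: h. Qed.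

Lemma induced_lact_subproof x (g : induced_forms) :
  lact G (iota x) (val g) \in span_pred induced_gen.
Proof.
case: g => g /= /asboolP; elim/linear_span_ind: g / => [|a v w].
  by rewrite linear0r rpred0.
move=> [y [z [t ->]]] hw; rewrite linearPr; apply: rpredD => //.
apply: rpredZ; apply/asboolP; apply: linear_span_sub.
by exists (x * y), z, t; rewrite rmorphM lM.
Qed.

Lemma induced_ract_subproof (g : induced_forms) x :
  ract G (val g) (iota x) \in span_pred induced_gen.
Proof.
case: g => g /= /asboolP; elim/linear_span_ind: g / => [|a v w].
  by rewrite linear0l rpred0.
move=> [y [z [t ->]]] hw; rewrite linearPl; apply: rpredD => //.
apply: rpredZ; apply/asboolP; apply: linear_span_sub.
by exists y, z, (t * x); rewrite rmorphM rM !lr.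
Qed.

Lemma induced_diff_subproof x :
  diff G (iota x) \in span_pred induced_gen.
Proof.
apply/asboolP; apply: linear_span_sub.
by exists 1, x, 1; rewrite rmorph1 l1 r1.
Qed.

Definition induced_lact (x : X) (g : induced_forms) : induced_forms :=
  Sub (lact G (iota x) (val g)) (induced_lact_subproof x g).
Definition induced_ract (g : induced_forms) (x : X) : induced_forms :=
  Sub (ract G (val g) (iota x)) (induced_ract_subproof g x).
Definition induced_diff (x : X) : induced_forms :=
  Sub (diff G (iota x)) (induced_diff_subproof x).

Lemma induced_lact_bilinear : bilinear_for *:%R *:%R induced_lact.
Proof.
split=> [g a x y|x a g h]; apply: val_inj; rewrite linearP !SubK.
  by rewrite linearP linearPl.
by rewrite !linearP.
Qed.
HB.instance Definition _ := bilinear_isBilinear.Build K X induced_forms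
  induced_forms *:%R *:%R induced_lact induced_lact_bilinear.

Lemma induced_ract_bilinear : bilinear_for *:%R *:%R induced_ract.
Proof.
split=> [x a g h|g a x y]; apply: val_inj; rewrite linearP !SubK.
  by rewrite linearPl.
by rewrite !linearP.
Qed.
HB.instance Definition _ := bilinear_isBilinear.Build K induced_forms X
  induced_forms *:%R *:%R induced_ract induced_ract_bilinear.

Lemma induced_diff_linear : linear induced_diff.
Proof. by move=> a x y; apply: val_inj; rewrite linearP !SubK !linearP. Qed.
HB.instance Definition _ := GRing.isLinear.Build K X induced_forms *:%R
  induced_diff induced_diff_linear.

Lemma induced_bimodule : is_bimodule induced_lact induced_ract.
Proof.
split=> [g|x y g|g|g x y|x g y]; apply: val_inj; rewrite !SubK.
- by rewrite rmorph1 l1.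
- by rewrite rmorphM lM.
- by rewrite rmorph1 r1.
- by rewrite rmorphM rM.
- exact: lr.
Qed.

Lemma induced_diffM x y : induced_diff (x * y) =
  induced_lact x (induced_diff y) + induced_ract (induced_diff x) y.
Proof. by apply: val_inj; rewrite linearD !SubK rmorphM diffM. Qed.

Lemma induced_span g : linear_span [set h | exists x y z,
  h = induced_lact x (induced_ract (induced_diff y) z)] g.
Proof.
case: g => g gP; have /asboolP hg := gP.
suff [h hP hE] : exists2 h : induced_forms, linear_span [set h | exists x y z,
    h = induced_lact x (induced_ract (induced_diff y) z)] h & val h = g.
  by rewrite (_ : exist _ g gP = h) //; apply: val_inj; rewrite hE.
elim/linear_span_ind: g / hg {gP} => [|a v w [x [y [z ->]]] [h hP <-]].
  by exists 0; [exact: linear_span0|rewrite linear0].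
exists (a *: induced_lact x (induced_ract (induced_diff y) z) + h).
  by apply: linear_spanP => //; apply: linear_span_sub; exists x, y, z.
by rewrite linearP.
Qed.

Definition induced_fodc : fodc X :=
  Fodc induced_bimodule induced_diffM induced_span.

End InducedCalculus.

(* The corepresentation has dimension n.+1 and its last index is ord_max.     *)
Section QuantumSpace.
Variables (K : fieldType) (A : hopfAlgType K) (r : universal_r_form A).
Variables (n : nat) (u : 'M[A]_n.+1).

Definition lrow (i : 'I_n.+1) : A -> K^o := Lminus r u ord_max i.

Definition alpha : K :=
  conv (lrow ord_max) (lrow ord_max) (u ord_max ord_max) - 1.

Definition tangent_basis (i : 'I_n.+1) : A -> K^o := fun a =>
  if i == ord_max then
    alpha^-1 * (conv (lrow ord_max) (lrow ord_max) a - counit a)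
  else alpha^-1 * conv (lrow i) (lrow ord_max) a.

Definition coord_set : set A := [set a | exists i, a = u i ord_max].

Definition coord_algebra : algType K := subalg_type coord_set.

Lemma coord_subproof i : u i ord_max \in subalg_pred coord_set.
Proof. by apply: mem_subalg; exists i. Qed.

Definition coord (i : 'I_n.+1) : coord_algebra :=
  (Sub (u i ord_max) (coord_subproof i) : subalg_type coord_set).

Definition coord_incl : {lrmorphism coord_algebra -> A} :=
  @subalg_incl K A coord_set.

Variable G : fodc A.

Definition coord_fodc : fodc coord_algebra := induced_fodc coord_incl G.

Definition forms_incl : {linear coord_fodc -> G} :=
  (\val : induced_forms coord_incl G -> G).

Definition dcoord (i : 'I_n.+1) : coord_fodc := diff coord_fodc (coord i).

Definition theta : G := omega G (u ord_max ord_max).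

Definition quadratic_relations
    (rho : coord_fodc -> coord_algebra -> coord_fodc) : Prop :=
  forall i j, rho (dcoord i) (coord j) =
    lrow ord_max (u ord_max ord_max) *:
      \sum_k \sum_m Rhat_inv r u i j k m *:
        lact coord_fodc (coord k) (dcoord m).

(* The coefficients are computed in A, hence the equality is taken in G.      *)
Definition general_relations
    (rho : coord_fodc -> coord_algebra -> coord_fodc) : Prop :=
  forall i (x : coord_algebra), forms_incl (rho (dcoord i) x) =
    \sum_m lact G
      (\sw_(x1, y <- comul (coord_incl x)) \sw_(x2, x3 <- comul y)
         rform_inv r (u i m ⊗ x1) *: (lrow ord_max x3 *: x2))
      (diff G (u m ord_max)).

End QuantumSpace.

(* Main.v *)
From HB Require Import structures.
Require Import Defs.
From mathcomp Require Import all_boot all_order all_algebra.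
From mathcomp Require Import boolp classical_sets functions reals.
From mathcomp Require Import complex.

(* Write N for the last index, lam = $l^{-N}_N$ and $F^k_i = l^{-k}_i lam$.   *)
(* By (a), lam is a character, so F is multiplicative as a matrix; hence the  *)
(* functionals X_i, which satisfy $F^N_i = α X_i + δ_{iN} ε$, obey the        *)
(* twisted Leibniz rule X_i(ab) = ε(a) X_i(b) + Σ_k X_k(a) F^k_i(b). By (b)   *)
(* and (c), X_i(x_j) = δ_ij, so the forms θ_i = ω(x_i) satisfy                *)
(* ω(a) = Σ_i X_i(a) θ_i. Therefore                                           *)
(*    da = Σ_i a_(1) X_i(a_(2)) θ_i,   θ_j b = Σ_i b_(1) F^j_i(b_(2)) θ_i,    *)
(* and j = N in the second formula is (ii), even for all b in A. Left         *)
(* invariance makes the θ_i, and the dx_i = Σ_k u^i_k θ_k, independent over   *)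
(* A. The inverse braiding relation moves the factor $u^i_k$ of dx_i . b      *)
(* across b, which expresses dx_i . b through the dx_m.                       *)

Set Implicit Arguments.
Unset Strict Implicit.
Unset Printing Implicit Defensive.
Import GRing.Theory.
Local Open Scope classical_set_scope.
Local Open Scope ring_scope.

(** * Linear maps, tensors and linear extension *)

(** The proof rests on a duality: by [tangent_basis_coord] the functionals $X_i$ are dual to the
    coordinates $x_j$, so [omegaE] expands every ω(a) in the forms θ_i. Comparing the twisted
    product rule [lhit_tangent_basisM] of the $X_i$ with the Leibniz rule of d yields right
    multiplication on the da ([diff_ract]) and hence on the θ_j ([omega_ract]); the last θ gives the
    commutator formula [diff_theta]. The braiding identity [rform_inv_commE] turns coefficients at
    the θ_k into coefficients at the dx_m ([diff_coord_ract]), and [Rhat_invE] recognises them on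
    generators as entries of $\hat R^{-1}$.

    Over $\mathcal X$, the quadratic relations move coordinates to the left of the dx_m with
    coefficients in $\mathcal X$, so the dx_m generate all forms ([coord_spanT]). Their independence
    holds over the whole of $\mathcal A$ ([diff_coord_free]): the θ_k are left-invariant and
    linearly independent over the scalars, hence independent over $\mathcal A$
    ([left_invariant_free]), and the matrix u from the θ_k to the dx_i is inverted by the antipode.
    Covariance descends because Δ(x_i) lies in $\mathcal A\otimes\mathcal X$. A right action is
    fixed by its values on generators of the left module and of the algebra, hence by the quadratic
    relations ([quadratic_unique]). *)

Section LinearMaps.
Variable K : fieldType.
Implicit Types U V W Z : lmodType K.

Lemma linear_id V : linear (fun x : V => x).
Proof. by []. Qed.

Lemma linear_of V W (f : {linear V -> W}) : linear f.
Proof. by move=> a x y; rewrite linearP. Qed.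

Lemma linear_mul_l (A : algType K) V (f : V -> A) (c : A) :
  linear f -> linear (fun x => f x * c).
Proof. by move=> hf a x y; rewrite hf mulrDl scalerAl. Qed.

Lemma linear_mul_r (A : algType K) V (f : V -> A) (c : A) :
  linear f -> linear (fun x => c * f x).
Proof. by move=> hf a x y; rewrite hf mulrDr scalerAr. Qed.

Lemma linear_scale_l U V (f : V -> K^o) (c : U) :
  linear f -> linear (fun x => f x *: c).
Proof. by move=> hf a x y; rewrite hf scalerDl scalerA. Qed.

Lemma linear_scale_r V W (f : V -> W) (c : K) :
  linear f -> linear (fun x => c *: f x).
Proof. by move=> hf a x y; rewrite hf scalerDr !scalerA mulrC. Qed.

Lemma linear_kmul_l V (f : V -> K^o) (c : K) :
  linear f -> linear (fun x => f x * c : K^o).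
Proof. by move=> hf a x y; rewrite hf mulrDl /= -mulrA. Qed.

Lemma linear_kmul_r V (f : V -> K^o) (c : K) :
  linear f -> linear (fun x => c * f x : K^o).
Proof. by move=> hf a x y; rewrite hf mulrDr /= mulrCA. Qed.

Lemma linear_sumf V W I (s : seq I) (P : pred I) (f : I -> V -> W) :
  (forall i, linear (f i)) -> linear (fun x => \sum_(i <- s | P i) f i x).
Proof.
move=> hf a x y; rewrite scaler_sumr -big_split.
by apply: eq_bigr => i _; rewrite hf.
Qed.

Lemma linear_addf V W (f g : V -> W) :
  linear f -> linear g -> linear (fun x => f x + g x).
Proof. by move=> hf hg a x y; rewrite hf hg scalerDr addrACA. Qed.

Lemma linear_oppf V W (f : V -> W) : linear f -> linear (fun x => - f x).
Proof. by move=> hf a x y; rewrite hf opprD scalerN. Qed.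

Lemma linear_matrix V m n (f : 'I_m -> 'I_n -> V -> K^o) :
  (forall i j, linear (f i j)) ->
  linear (fun x => \matrix_(i, j) f i j x : 'M[K]_(m, n)).
Proof. by move=> hf a x y; apply/matrixP => i j; rewrite !mxE hf. Qed.

Lemma linear_of_comp U V W (f : {linear V -> W}) (g : U -> V) :
  linear g -> linear (fun x => f (g x)).
Proof. by move=> hg a x y; rewrite hg linearP. Qed.

Lemma linear_comp U V W (f : V -> W) (g : U -> V) :
  linear f -> linear g -> linear (fun x => f (g x)).
Proof. by move=> hf hg a x y; rewrite hg hf. Qed.

Lemma linear_bilin_l U V W Z (f : {bilinear V -> W -> Z}) (g : U -> V) w :
  linear g -> linear (fun x => f (g x) w).
Proof. by move=> hg a x y; rewrite hg linearPl. Qed.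

Lemma linear_bilin_r U V W Z (f : {bilinear V -> W -> Z}) (g : U -> W) v :
  linear g -> linear (fun x => f v (g x)).
Proof. by move=> hg a x y; rewrite hg linearPr. Qed.

Lemma linear_map_sum V W (f : V -> W) I (s : seq I) (P : pred I) F :
  linear f -> f (\sum_(i <- s | P i) F i) = \sum_(i <- s | P i) f (F i).
Proof.
move=> hf.
pose g : {linear V -> W} := HB.pack f (GRing.isLinear.Build K V W _ f hf).
exact: (linear_sum g).
Qed.

Lemma linear_mapZ V W (f : V -> W) a x : linear f -> f (a *: x) = a *: f x.
Proof.
move=> hf.
pose g : {linear V -> W} := HB.pack f (GRing.isLinear.Build K V W _ f hf).
exact: (linearZ_LR g).
Qed.

Lemma linear_map0 V W (f : V -> W) : linear f -> f 0 = 0.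
Proof. by move=> hf; rewrite -[X in f X](scale0r 0) linear_mapZ // scale0r. Qed.

Lemma linear_mapB V W (f : V -> W) x y : linear f -> f (x - y) = f x - f y.
Proof.
move=> hf.
pose g : {linear V -> W} := HB.pack f (GRing.isLinear.Build K V W _ f hf).
exact: (linearB g).
Qed.

Lemma sum_delta V (I : finType) (v : I -> V) (i : I) :
  \sum_k (i == k)%:R *: v k = v i.
Proof.
rewrite (bigD1 i) //= eqxx scale1r big1 ?addr0 // => k.
by rewrite eq_sym => /negPf ->; rewrite scale0r.
Qed.

Lemma sum_delta_r V (I : finType) (v : I -> V) (i : I) :
  \sum_k (k == i)%:R *: v k = v i.
Proof. by rewrite -[RHS]sum_delta; apply: eq_bigr => k _; rewrite eq_sym. Qed.

Definition bilin U V W (b : U -> V -> W) : Prop :=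
  (forall v, linear (b^~ v)) /\ (forall u, linear (b u)).

Lemma sw_bilinear U V W (b : U -> V -> W) : bilin b -> linear (tlift b).
Proof.
case=> h1 h2.
pose g : {bilinear U -> V -> W} :=
  HB.pack b (bilinear_isBilinear.Build K U V W *:%R *:%R b (h1, h2)).
exact: (tlift_is_linear g).
Qed.

Lemma sw_pure U V W (b : U -> V -> W) u v : bilin b -> tlift b (u ⊗ v) = b u v.
Proof.
case=> h1 h2.
pose g : {bilinear U -> V -> W} :=
  HB.pack b (bilinear_isBilinear.Build K U V W *:%R *:%R b (h1, h2)).
exact: (tliftE g).
Qed.

Lemma sw_sum U V W (b : U -> V -> W) I (s : seq I) (P : pred I) f g :
  bilin b -> tlift b (\sum_(i <- s | P i) f i ⊗ g i) =
             \sum_(i <- s | P i) b (f i) (g i).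
Proof.
move=> hb; rewrite (linear_map_sum _ _ _ (sw_bilinear hb)).
by apply: eq_bigr => i _; rewrite sw_pure.
Qed.

Lemma linear_sw U V W Z (f : W -> Z) (b : U -> V -> W) t :
  linear f -> f (\sw_(x, y <- t) b x y) = \sw_(x, y <- t) f (b x y).
Proof. exact: linear_map_sum. Qed.

Lemma sw_mull U V (B : algType K) (b : U -> V -> B) c t :
  (\sw_(x, y <- t) b x y) * c = \sw_(x, y <- t) b x y * c.
Proof. exact: mulr_suml. Qed.

Lemma sw_mulr U V (B : algType K) (b : U -> V -> B) c t :
  c * (\sw_(x, y <- t) b x y) = \sw_(x, y <- t) c * b x y.
Proof. exact: mulr_sumr. Qed.

Lemma sw_scalel U V W (b : U -> V -> K^o) (c : W) t :
  (\sw_(x, y <- t) b x y) *: c = \sw_(x, y <- t) (b x y : K) *: c.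
Proof. exact: scaler_suml. Qed.

Lemma sw_scaler U V W (b : U -> V -> W) (c : K) t :
  c *: (\sw_(x, y <- t) b x y) = \sw_(x, y <- t) c *: b x y.
Proof. exact: scaler_sumr. Qed.

Lemma eq_sw U V (W : nmodType) (b c : U -> V -> W) t :
  (forall x y, b x y = c x y) -> \sw_(x, y <- t) b x y = \sw_(x, y <- t) c x y.
Proof. by move=> h; apply: eq_bigr. Qed.

Lemma sw_sumr U V (W : nmodType) I (s : seq I) (P : pred I)
    (b : I -> U -> V -> W) t :
  \sw_(x, y <- t) \sum_(i <- s | P i) b i x y =
  \sum_(i <- s | P i) \sw_(x, y <- t) b i x y.
Proof. exact: exchange_big. Qed.

Lemma linear_swf U V W Z (b : Z -> U -> V -> W) t :
  (forall x y, linear (fun z => b z x y)) ->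
  linear (fun z => \sw_(x, y <- t) b z x y).
Proof. by move=> h; apply: linear_sumf. Qed.

Lemma linear_sw_arg U V W Z (b : U -> V -> W) (f : Z -> tensor U V) :
  bilin b -> linear f -> linear (fun z => \sw_(x, y <- f z) b x y).
Proof. by move=> hb hf a x y; rewrite hf (sw_bilinear hb). Qed.

Lemma tensorE U V (t : tensor U V) : t = \sw_(x, y <- t) x ⊗ y.
Proof.
apply: tensor_ext => W b; rewrite (linear_sw _ _ (tlift_is_linear b)).
by apply: eq_sw => x y; rewrite tliftE.
Qed.

Lemma sw_tmap U U' V V' W (b : U' -> V' -> W) (f : U -> U') (g : V -> V') t :
  bilin b -> \sw_(x, y <- tmap f g t) b x y = \sw_(x, y <- t) b (f x) (g y).
Proof. by move=> hb; rewrite /tmap {2}/tlift /tens_eval sw_sum. Qed.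

(* A maximal single-valued submodule of [V * U] containing the given one is   *)
(* the graph of a map defined everywhere.                                     *)
Lemma linear_extension V U (D : set (V * U)) :
  (forall a p q, D p -> D q -> D (a *: p + q)) ->
  (forall w, D (0, w) -> w = 0) ->
  exists f : {linear V -> U}, forall v w, D (v, w) -> f v = w.
Proof.
move=> Dlin Dsv.
pose good (B : set (V * U)) := [/\ forall a p q, B p -> B q -> B (a *: p + q),
   forall w, B (0, w) -> w = 0, B (0, 0) & D `<=` B].
have D00 : forall p, D p -> D (0, 0).
  by move=> p Dp; have := Dlin (-1) p p Dp Dp; rewrite scaleN1r addNr.
have [B [PB Bmax]] : exists B, (B = set0 \/ good B) /\
    forall C, (B `<` C)%classic -> ~ (C = set0 \/ good C).
  apply: Zorn_bigcup => F FP Ftot.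
  have [[C [FC gC]]|noC] := pselect (exists C, F C /\ good C); last first.
    left; apply/seteqP; split=> // p [C FC Cp].
    by case: (FP C FC) Cp => [->//|gC]; case: noC; exists C.
  right; split.
  - move=> a p q [X FX Xp] [Y FY Yq].
    have [X0|[Xl _ _ _]] := FP X FX; first by rewrite X0 in Xp.
    have [Y0|[Yl _ _ _]] := FP Y FY; first by rewrite Y0 in Yq.
    have [XY|YX] := Ftot X Y FX FY.
      by exists Y => //; apply: Yl => //; apply: XY.
    by exists X => //; apply: Xl => //; apply: YX.
  - move=> w [X FX Xw]; have [X0|[_ Xs _ _]] := FP X FX; last exact: Xs.
    by rewrite X0 in Xw.
  - by exists C => //; case: gC.
  - by move=> p Dp; exists C => //; case: gC => _ _ _; apply.
(* [D] may be empty; adding the zero pair gives a good set, which shows that the maximal [B] is not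
   empty. *)
pose D1 : set (V * U) := [set p | D p \/ p = (0, 0)].
have gD1 : good D1.
  split.
  - move=> a p q [Dp|->] [Dq|->]; rewrite -?[(0, 0)]/(0 : V * U)%type
      ?scaler0 ?add0r ?addr0.
    + by left; apply: Dlin.
    + by left; have := Dlin a p _ Dp (D00 _ Dp); rewrite addr0.
    + by left.
    + by right.
  - by move=> w [/Dsv|[->]].
  - by right.
  - by move=> p Dp; left.
have gB : good B.
  case: PB => // B0; case: (Bmax D1); last by right.
  rewrite B0; split=> // /(_ (0, 0)); apply; by right.
have {PB} [Bl Bs B00 DB] := gB.
have Btot v : exists w, B (v, w).
  apply: contrapT => nv.
  (* If v were outside the domain of [B], giving it the value 0 would extend [B] properly. *)
  pose C : set (V * U) := [set p | exists c q, B q /\ p = (q.1 + c *: v, q.2)].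
  case: (Bmax C).
    split=> [p Bp|].
      by exists 0, p; rewrite scale0r addr0; split=> //; case: p Bp.
    move=> CB; apply: nv; exists 0; apply: CB; exists 1, (0, 0).
    by rewrite scale1r add0r.
  right; split.
  - move=> a p q [c [p' [Bp ->]]] [d [q' [Bq ->]]].
    exists (a * c + d), (a *: p' + q'); split; first exact: Bl.
    apply: injective_projections => //=.
    by rewrite scalerDr scalerDl scalerA addrACA.
  - move=> w [c [[x y] [Bxy [/= hx ->]]]].
    have [c0|c0] := eqVneq c 0.
      by apply: Bs; rewrite hx c0 scale0r addr0.
    case: nv; exists (- c^-1 *: y).
    have -> : (v, - c^-1 *: y) = - c^-1 *: (x, y) + 0.
      apply: injective_projections; rewrite /= addr0 //.
      have /eqP : x + c *: v = 0 by rewrite -hx.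
      rewrite addr_eq0 => /eqP ->.
      by rewrite scalerN scaleNr opprK scalerA mulVf // scale1r.
    exact: Bl.
  - by exists 0, (0, 0); rewrite scale0r addr0.
  - move=> p /DB Bp; exists 0, p; split=> //.
    by rewrite scale0r addr0; case: p Bp.
have [f Bf] := choice Btot.
have Buniq v w : B (v, w) -> w = f v.
  move=> Bw; have := Bl (-1) _ _ (Bf v) Bw.
  rewrite scaleN1r /= => h; apply/eqP; rewrite -subr_eq0 addrC; apply/eqP.
  apply: Bs; congr B: h.
  by apply: injective_projections; rewrite /= ?addNr.
have fl : linear f.
  by move=> a x y; apply/esym/Buniq; apply: (Bl a (x, f x) (y, f y)).
pose g : {linear V -> U} := HB.pack f (GRing.isLinear.Build K V U _ f fl).
by exists g => v w /DB /Buniq ->.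
Qed.

Lemma linear_retraction V W (f : {linear W -> V}) :
  injective f -> exists g : {linear V -> W}, cancel f g.
Proof.
move=> fI.
have [||g hg] := @linear_extension V W [set p | p.1 = f p.2].
- by move=> a p q /= -> ->; rewrite linearP.
- by move=> w /= h; apply: fI; rewrite linear0.
by exists g => w; apply: hg.
Qed.

Lemma functional_neq0 V (v : V) :
  v != 0 -> exists f : {linear V -> K^o}, f v = 1.
Proof.
move=> v0; have [||f hf] :=
    @linear_extension V K^o [set p | p.1 = (p.2 : K) *: v].
- by move=> a p q /= -> ->; rewrite scalerDl scalerA.
- by move=> w /= /esym/eqP; rewrite scaler_eq0 (negPf v0) orbF => /eqP.
by exists f; apply: hf; rewrite /= scale1r.
Qed.

(** Independence makes the j-th coordinate well defined on the span of t; it is then extended to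
    V. *)
Lemma dual_functionals V (I : finType) (t : I -> V) :
  (forall c : I -> K, \sum_i c i *: t i = 0 -> forall i, c i = 0) ->
  forall j, exists e : {linear V -> K^o}, forall i, e (t i) = (i == j)%:R.
Proof.
move=> tfree j; have [||e he] := @linear_extension V K^o
    [set p | exists c : I -> K, p = (\sum_i c i *: t i, c j : K^o)].
- move=> a p q [c ->] [d ->]; exists (fun i => a * c i + d i).
  apply: injective_projections => //=; rewrite scaler_sumr -big_split.
  by apply: eq_bigr => i _; rewrite scalerDl scalerA.
- by move=> w [c [/esym/tfree/(_ j) cj ->]].
exists e => i; apply: he; exists (fun k => (i == k)%:R).
congr (_, _); rewrite (bigD1 i) //= eqxx scale1r big1 ?addr0 // => k.
by rewrite eq_sym => /negPf ->; rewrite scale0r.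
Qed.

End LinearMaps.

(** * Sweedler calculus in a Hopf algebra *)

Lemma linear_scalar_comp (K : fieldType) (U V : lmodType K) (f : {scalar V})
    (g : U -> V) : linear g -> linear (fun x => f (g x) : K^o).
Proof. by move=> hg a x y; rewrite hg linearP. Qed.

(** Linearity of a Sweedler expression in one variable is shown by descent through its syntax.
    Linearity hypotheses of the context are tried before the general rules. *)
Ltac lin_step :=
  match goal with
  | |- bilin _ => split=> ? /=
  | H : linear ?f |- linear (fun x => ?f (@?g x)) =>
      apply: (@linear_comp _ _ _ _ f g H)
  | H : forall i j, linear (?f i j) |- linear (fun x => ?f ?i ?j (@?g x)) =>
      apply: (@linear_comp _ _ _ _ (f i j) g (H i j))
  | H : forall i, linear (?f i) |- linear (fun x => ?f ?i (@?g x)) =>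
      apply: (@linear_comp _ _ _ _ (f i) g (H i))
  | |- linear (fun x => tlift _ _) =>
      first [apply: linear_swf => ? ? /= | apply: linear_sw_arg]
  | _ => first
    [ done
    | exact: linear_id
    | apply: linear_scalar_comp
    | apply: linear_of_comp
    | apply: linear_bilin_l | apply: linear_bilin_r
    | apply: linear_mul_l | apply: linear_mul_r
    | apply: linear_scale_l | apply: linear_scale_r
    | apply: linear_kmul_l | apply: linear_kmul_r
    | apply: linear_sumf => ? /=
    | apply: linear_addf | apply: linear_oppf ]
  end.
Ltac lin := repeat (lin_step; rewrite /=).

Section Sweedler.
Variables (K : fieldType) (A : hopfAlgType K).
Implicit Types (U V W : lmodType K) (B : algType K).

(** A trilinear [T] induces a linear map on A ⊗ (A ⊗ A), which is applied to both sides of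
    [comulA]. *)
Lemma coassoc W (T : A -> A -> A -> W) (a : A) :
  (forall y z, linear (fun x => T x y z)) ->
  (forall x z, linear (fun y => T x y z)) ->
  (forall x y, linear (fun z => T x y z)) ->
  \sw_(x, z <- comul a) \sw_(x1, x2 <- comul x) T x1 x2 z =
  \sw_(x, z <- comul a) \sw_(z1, z2 <- comul z) T x z1 z2.
Proof.
move=> h1 h2 h3.
pose Psi (t : tensor A (tensor A A)) :=
  \sw_(x, s <- t) \sw_(y, z <- s) T x y z.
have Tb x : bilin (T x) by split.
have Pb : bilin (fun x s => \sw_(y, z <- s) T x y z : W).
  by split=> [s|x]; [apply: linear_swf | apply: sw_bilinear].
have PsiL : linear Psi by apply: sw_bilinear.
have := congr1 Psi (comulA a).
rewrite {2}/Psi sw_tmap //= => <-.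
rewrite /tassoc sw_tmap; last by lin.
rewrite (linear_sw _ _ PsiL); apply: eq_sw => x z.
rewrite (linear_sw _ _ PsiL); apply: eq_sw => x1 x2.
by rewrite /Psi sw_pure // sw_pure.
Qed.

Lemma sw_comulM W (b : A -> A -> W) (a c : A) : bilin b ->
  \sw_(x, y <- comul (a * c)) b x y =
  \sw_(x, y <- comul a) \sw_(x', y' <- comul c) b (x * x') (y * y').
Proof.
move=> hb; rewrite comulM /tmul (linear_sw _ _ (sw_bilinear hb)).
apply: eq_sw => x y; rewrite (linear_sw _ _ (sw_bilinear hb)).
by apply: eq_sw => x' y'; rewrite sw_pure.
Qed.

Lemma sw_counitl W (f : A -> W) a :
  linear f -> \sw_(x, y <- comul a) counit x *: f y = f a.
Proof.
move=> hf; rewrite -[in RHS](counitl a) (linear_sw _ _ hf).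
by apply: eq_sw => x y; rewrite linear_mapZ.
Qed.

Lemma sw_counitr W (f : A -> W) a :
  linear f -> \sw_(x, y <- comul a) counit y *: f x = f a.
Proof.
move=> hf; rewrite -[in RHS](counitr a) (linear_sw _ _ hf).
by apply: eq_sw => x y; rewrite linear_mapZ.
Qed.

Section Convolution.
Variable B : algType K.
Implicit Types f g h M N : A -> B.

(** The values lie in any algebra [B], so that matrices of functionals can be convolved and inverted
    as single elements. *)
Definition cv f g : A -> B := fun a => \sw_(x, y <- comul a) f x * g y.
Definition cv1 : A -> B := fun a => counit a *: 1.

Lemma cvA f g h : linear f -> linear g -> linear h ->
  cv f (cv g h) = cv (cv f g) h.
Proof.
move=> hf hg hh; apply: functional_extensionality_dep => a; rewrite /cv.
transitivity (\sw_(x, z <- comul a) \sw_(x1, x2 <- comul x) f x1 * g x2 * h z).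
  rewrite coassoc; try by move=> *; lin.
  apply: eq_sw => x y; rewrite sw_mulr.
  by apply: eq_sw => y1 y2; rewrite mulrA.
by apply: eq_sw => x y; rewrite sw_mull.
Qed.

Lemma cv1f f : linear f -> cv cv1 f = f.
Proof.
move=> hf; apply: functional_extensionality_dep => a; rewrite -[RHS]sw_counitl //.
by apply: eq_sw => x y; rewrite -scalerAl mul1r.
Qed.

Lemma cvf1 f : linear f -> cv f cv1 = f.
Proof.
move=> hf; apply: functional_extensionality_dep => a; rewrite -[RHS]sw_counitr //.
by apply: eq_sw => x y; rewrite -scalerAr mulr1.
Qed.

Lemma cv_cancelr M N f g : linear M -> linear N -> linear f ->
  cv M N = cv1 -> cv f M = g -> f = cv g N.
Proof. by move=> hM hN hf MN <-; rewrite -cvA // MN cvf1. Qed.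

End Convolution.

(** The left regular action of the dual algebra on A; [rhit] below is the right one. *)
Definition lhit (phi : A -> K^o) (a : A) : A :=
  \sw_(x, y <- comul a) (phi y : K) *: x.

Lemma lhit_linear phi : linear phi -> linear (lhit phi).
Proof. by move=> h; apply: linear_sw_arg; lin. Qed.

Lemma lhit_counit a : lhit counit a = a.
Proof. exact: counitr. Qed.

Lemma lhit_conv phi psi a : linear phi -> linear psi ->
  lhit (conv phi psi) a = lhit phi (lhit psi a).
Proof.
move=> h1 h2; rewrite [lhit psi a]/lhit (linear_sw (f := lhit phi)); last exact: lhit_linear.
transitivity (\sw_(x, z <- comul a) \sw_(x1, x2 <- comul x)
                (psi z : K) *: ((phi x2 : K) *: x1)).
  rewrite coassoc; try by move=> *; lin.
  apply: eq_sw => x y; rewrite sw_scalel.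
  by apply: eq_sw => y1 y2; rewrite scalerA mulrC.
apply: eq_sw => x y; by rewrite (linear_mapZ _ _ (lhit_linear h1)) sw_scaler.
Qed.

(** The functions f and g play the role of the coproduct Σ f_i ⊗ g_i of φ in the dual. *)
Lemma lhit_mul (I : finType) (phi : A -> K^o) (f g : I -> A -> K^o) a b :
  linear phi -> (forall a b, phi (a * b) = \sum_i f i a * g i b) ->
  lhit phi (a * b) = \sum_i lhit (f i) a * lhit (g i) b.
Proof.
move=> hphi h; rewrite /lhit sw_comulM; last by lin.
under eq_bigr do rewrite /tlift /tens_eval big_distrlr /=.
rewrite exchange_big; apply: eq_bigr => p _.
rewrite exchange_big; apply: eq_bigr => q _.
rewrite h scaler_suml; apply: eq_bigr => i _.
by rewrite -scalerAl -scalerAr scalerA.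
Qed.

Lemma comul_lhit W (b : A -> A -> W) phi a : linear phi -> bilin b ->
  \sw_(x, y <- comul (lhit phi a)) b x y = \sw_(x, y <- comul a) b x (lhit phi y).
Proof.
move=> h hb; have [hb1 hb2] := hb.
have hbc : linear (fun z => \sw_(x, y <- comul z) b x y) by apply: linear_sw_arg => //; lin.
rewrite /lhit (linear_sw _ _ hbc).
transitivity (\sw_(x, z <- comul a) \sw_(x1, x2 <- comul x)
                (phi z : K) *: b x1 x2).
  by apply: eq_sw => x y; rewrite (linear_mapZ _ _ hbc)
    sw_scaler.
rewrite coassoc; last first.
- by move=> *; lin.
- by move=> x z; apply: linear_scale_r.
- by move=> x z; apply: linear_scale_r.
apply: eq_sw => x y; rewrite (linear_sw _ _ (hb2 x)).
by apply: eq_sw => y1 y2; rewrite (linear_mapZ _ _ (hb2 x)).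
Qed.

Definition rhit (phi : A -> K^o) (a : A) : A :=
  \sw_(x, y <- comul a) (phi x : K) *: y.

Lemma rhit_linear phi : linear phi -> linear (rhit phi).
Proof. by move=> h; apply: linear_sw_arg; lin. Qed.

Lemma rhit_counit a : rhit counit a = a.
Proof. exact: counitl. Qed.

Lemma rhit_conv phi psi a : linear phi -> linear psi ->
  rhit (conv phi psi) a = rhit psi (rhit phi a).
Proof.
move=> h1 h2; rewrite [rhit phi a]/rhit (linear_sw _ _ (rhit_linear h2)).
transitivity (\sw_(x, z <- comul a) \sw_(z1, z2 <- comul z)
                (phi x : K) *: ((psi z1 : K) *: z2)).
  rewrite -(@coassoc _ (fun x y z => (phi x : K) *: ((psi y : K) *: z)));
    try by move=> *; lin.
  apply: eq_sw => x y; rewrite sw_scalel.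
  by apply: eq_sw => y1 y2; rewrite scalerA.
by apply: eq_sw => x y; rewrite (linear_mapZ _ _ (rhit_linear h2)) sw_scaler.
Qed.

Lemma lhit_rt phi psi a : linear phi -> linear psi ->
  lhit phi (rhit psi a) = rhit psi (lhit phi a).
Proof.
move=> h1 h2; rewrite [rhit psi a]/rhit (linear_sw _ _ (lhit_linear h1)).
rewrite [lhit phi a]/lhit (linear_sw _ _ (rhit_linear h2)).
transitivity (\sw_(x, z <- comul a) \sw_(z1, z2 <- comul z)
                (psi x : K) *: ((phi z2 : K) *: z1)).
  by apply: eq_sw => x y; rewrite (linear_mapZ _ _ (lhit_linear h1)) sw_scaler.
rewrite -(@coassoc _ (fun x y z => (psi x : K) *: ((phi z : K) *: y)));
  try by move=> *; lin.
apply: eq_sw => x y; rewrite (linear_mapZ _ _ (rhit_linear h2)) sw_scaler.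
by apply: eq_sw => x1 x2; rewrite !scalerA mulrC.
Qed.

Lemma lhit_sum (I : finType) (phi : I -> A -> K^o) a :
  lhit (fun x => \sum_i phi i x) a = \sum_i lhit (phi i) a.
Proof. by rewrite -sw_sumr; apply: eq_sw => x y; rewrite scaler_suml. Qed.

Lemma rhit_sum (I : finType) (phi : I -> A -> K^o) a :
  rhit (fun x => \sum_i phi i x) a = \sum_i rhit (phi i) a.
Proof. by rewrite -sw_sumr; apply: eq_sw => x y; rewrite scaler_suml. Qed.

Lemma lhit_eps (c : K) (phi : A -> K^o) b :
  (forall a, phi a = c * counit a) -> lhit phi b = c *: b.
Proof.
move=> h; rewrite -[in RHS](lhit_counit b) /lhit sw_scaler.
by apply: eq_sw => x y; rewrite h scalerA.
Qed.

Lemma rhit_eps (c : K) (phi : A -> K^o) b :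
  (forall a, phi a = c * counit a) -> rhit phi b = c *: b.
Proof.
move=> h; rewrite -[in RHS](rhit_counit b) /rhit sw_scaler.
by apply: eq_sw => x y; rewrite h scalerA.
Qed.

Section Corep.
Variables (n : nat) (u : 'M[A]_n).
Hypothesis uc : matrix_corepresentation u.

Lemma sw_corep W (b : A -> A -> W) i j : bilin b ->
  \sw_(x, y <- comul (u i j)) b x y = \sum_k b (u i k) (u k j).
Proof. by move=> hb; rewrite uc.1 sw_sum. Qed.

Lemma corep_antipodel i j :
  \sum_k antipode (u i k) * u k j = (i == j)%:R%:A.
Proof.
rewrite -(@sw_corep _ (fun x y => antipode x * y)); last by lin.
by rewrite antipodel uc.2.
Qed.

Lemma corep_antipoder i j :
  \sum_k u i k * antipode (u k j) = (i == j)%:R%:A.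
Proof.
rewrite -(@sw_corep _ (fun x y => x * antipode y)); last by lin.
by rewrite antipoder uc.2.
Qed.

Lemma lhit_corep phi i j : linear phi ->
  lhit phi (u i j) = \sum_k (phi (u k j) : K) *: u i k.
Proof. by move=> h; rewrite /lhit sw_corep //; lin. Qed.

End Corep.
End Sweedler.

(** * L-functionals *)

Section LFunctionals.
Variables (K : fieldType) (A : hopfAlgType K) (r : universal_r_form A).
Variables (n : nat) (u : 'M[A]_n.+1).
Hypothesis uc : matrix_corepresentation u.
Implicit Types (a b : A) (i j k m : 'I_n.+1).

Local Notation l := (Lminus r u).

(** This is not $l^+$, where the matrix element stands in the second slot. It is the matrix inverse
    of $l^-$ under convolution. *)
Definition rrow i j : A -> K^o := fun a => rform r (u i j ⊗ a).

Lemma Lminus_linear i j : linear (l i j).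
Proof. by rewrite /Lminus => a x y; rewrite linearPr linearP. Qed.

Lemma rrow_linear i j : linear (rrow i j).
Proof. by rewrite /rrow => a x y; rewrite linearPr linearP. Qed.

#[local] Hint Resolve Lminus_linear rrow_linear : core.

Lemma conv_linear (f g : A -> K^o) : linear f -> linear g -> linear (conv f g).
Proof. by move=> hf hg; apply: linear_sw_arg; lin. Qed.

Lemma rrow_LminusE i j a :
  \sum_k conv (rrow i k) (l k j) a = (i == j)%:R * counit a.
Proof.
rewrite -uc.2 -(rform_convr r); apply/esym.
apply: (eq_trans (@sw_corep _ _ _ _ uc K^o _ _ _ _)) => //.
  split=> x; apply: linear_swf => y z /= c s t.
    by rewrite linearPl linearP mulrDl -mulrA.
  by rewrite linearPl linearP mulrDr mulrCA.
Qed.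

Lemma Lminus_rrowE i j a :
  \sum_k conv (l i k) (rrow k j) a = (i == j)%:R * counit a.
Proof.
rewrite -uc.2 -(rform_convl r); apply/esym.
apply: (eq_trans (@sw_corep _ _ _ _ uc K^o _ _ _ _)) => //.
  split=> x; apply: linear_swf => y z /= c s t.
    by rewrite linearPl linearP mulrDl -mulrA.
  by rewrite linearPl linearP mulrDr mulrCA.
Qed.

(** [rformMr] reverses the order of the factors, so [rrow] is antimultiplicative as a matrix; its
    convolution inverse will therefore be multiplicative. *)
Lemma rrowM i j a b : rrow i j (a * b) = \sum_k rrow i k b * rrow k j a.
Proof.
rewrite /rrow rformMr.
apply: (eq_trans (@sw_corep _ _ _ _ uc K^o _ _ _ _)) => //.
split=> x c s t /=.
  by rewrite linearPl linearP mulrDl -mulrA.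
by rewrite linearPl linearP mulrDr mulrCA.
Qed.

Let Mb a : 'M[K]_n.+1 := \matrix_(i, j) l i j a.
Let M a : 'M[K]_n.+1 := \matrix_(i, j) rrow i j a.

Let Mb_linear : linear Mb. Proof. exact: linear_matrix. Qed.
Let M_linear : linear M. Proof. exact: linear_matrix. Qed.

Let cvE (f g : A -> 'M[K]_n.+1) a i j :
  cv f g a i j = \sum_k conv (fun x => f x i k) (fun x => g x k j) a.
Proof.
rewrite /cv /conv -sw_sumr /tlift /tens_eval summxE.
by apply: eq_bigr => p _; rewrite mxE.
Qed.

Let MMb : cv M Mb = @cv1 _ _ _.
Proof.
apply: functional_extensionality_dep => a; apply/matrixP => i j.
rewrite cvE !mxE -mulr_natr mul1r mulrC -rrow_LminusE; apply: eq_bigr => k _.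
by apply: eq_sw => x y; rewrite !mxE.
Qed.

Let MbM : cv Mb M = @cv1 _ _ _.
Proof.
apply: functional_extensionality_dep => a; apply/matrixP => i j.
rewrite cvE !mxE -mulr_natr mul1r mulrC -Lminus_rrowE; apply: eq_bigr => k _.
by apply: eq_sw => x y; rewrite !mxE.
Qed.

Let MM a b : M (a * b) = M b * M a.
Proof.
apply/matrixP => i j; rewrite !mxE rrowM.
by apply: eq_bigr => k _; rewrite !mxE.
Qed.

(* $l^-(ab)$ is the convolution inverse of $ab \mapsto M(ab) = M(b) M(a)$;    *)
(* one cancels M first in the variable a, then in b.                          *)
Let MbMul a b : Mb (a * b) = Mb a * Mb b.
Proof.
have h1 e c : \sw_(x, y <- comul e) Mb (c * x) * M y = counit e *: Mb c.
  have hP : linear (fun c => \sw_(x, y <- comul e) Mb (c * x) * M y) by lin.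
  have hQ : cv (fun c => \sw_(x, y <- comul e) Mb (c * x) * M y) M =
            (fun c => counit e *: cv1 _ c).
    apply: functional_extensionality_dep => d.
    have := congr1 (fun f => f (d * e)) MbM.
    rewrite /cv sw_comulM; last by lin.
    rewrite /cv1 counitM mulrC -scalerA => <-.
    apply: eq_sw => x y; rewrite sw_mull; apply: eq_sw => x' y'.
    by rewrite MM mulrA.
  have := cv_cancelr M_linear Mb_linear hP MMb hQ.
  move/(congr1 (fun f => f c)) => ->.
  have <- : cv (@cv1 _ _ _) Mb c = Mb c by rewrite cv1f.
  rewrite /cv sw_scaler.
  by apply: eq_sw => x y; rewrite -scalerAl.
have hP : linear (fun c => Mb (a * c)) by lin.
have hQ : cv (fun c => Mb (a * c)) M = (fun c => Mb a * cv1 _ c).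
  apply: functional_extensionality_dep => c.
  by rewrite [LHS]h1 /cv1 -scalerAr mulr1.
have := cv_cancelr M_linear Mb_linear hP MMb hQ.
move/(congr1 (fun f => f b)) => ->.
have <- : cv (@cv1 _ _ _) Mb b = Mb b by rewrite cv1f.
rewrite /cv sw_mulr.
by apply: eq_sw => x y; rewrite mulrA.
Qed.

Lemma LminusM i j a b : l i j (a * b) = \sum_k l i k a * l k j b.
Proof.
have := congr1 (fun X : 'M_n.+1 => X i j) (MbMul a b); rewrite !mxE => ->.
by apply: eq_bigr => k _; rewrite !mxE.
Qed.

(** The axiom [rform_comm] with a matrix element as first argument, written with the two regular
    actions on b. *)
Lemma rform_commE i m b :
  \sum_k u k m * rhit (rrow i k) b = \sum_k lhit (rrow k m) b * u i k.
Proof.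
have := rform_comm r (u i m) b.
rewrite (@sw_corep _ _ _ _ uc A); last first.
  split=> x; apply: linear_swf => y z /= c s t.
    by rewrite linearPl linearP scalerDl scalerA.
  by rewrite mulrDl -scalerAl scalerDr !scalerA mulrC.
rewrite (@sw_corep _ _ _ _ uc A); last first.
  split=> x; apply: linear_swf => y z /= c s t.
    by rewrite mulrDr -scalerAr scalerDr !scalerA mulrC.
  by rewrite linearPl linearP scalerDl scalerA.
move=> h; transitivity (\sum_k \sw_(b1, b2 <- comul b)
    rform r (u i k ⊗ b1) *: (u k m * b2)).
  apply: eq_bigr => k _; rewrite /rhit sw_mulr.
  by apply: eq_sw => x y; rewrite -scalerAr.
rewrite h; apply: eq_bigr => k _; rewrite /lhit sw_mull.
by apply: eq_sw => x y; rewrite -scalerAl.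
Qed.

(* The inverse braiding relation $a_(1) b_(1) \bar r(a_(2), b_(2)) = \bar     *)
(* r(a_(1), b_(1)) b_(2) a_(2)$ for matrix elements a, by sandwiching         *)
(* rform_commE between two copies of $l^-$.                                   *)
Lemma rform_inv_commE i j b :
  \sum_k u i k * lhit (l k j) b = \sum_k rhit (l i k) b * u k j.
Proof.
transitivity (\sum_k \sum_m \sum_p
    u m p * rhit (rrow k m) (rhit (l i k) (lhit (l p j) b))).
  rewrite exchange_big; under [RHS]eq_bigr do rewrite exchange_big.
  transitivity (\sum_m \sum_p (i == m)%:R *: (u m p * lhit (l p j) b)).
    rewrite -[LHS](sum_delta (fun m => \sum_p u m p * lhit (l p j) b)).
    by apply: eq_bigr => m _; rewrite scaler_sumr.
  apply: eq_bigr => m _; apply: eq_bigr => p _; rewrite -mulr_sumr scalerAr.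
  congr (_ * _); rewrite -(rhit_eps _ (Lminus_rrowE i m)) rhit_sum.
  by apply: eq_bigr => k _; rewrite rhit_conv.
apply: eq_bigr => k _; rewrite exchange_big /=.
transitivity (\sum_p \sum_m lhit (rrow m p) (lhit (l p j) (rhit (l i k) b)) * u k m).
  apply: eq_bigr => p _; rewrite -rform_commE; apply: eq_bigr => m _.
  by rewrite lhit_rt.
rewrite exchange_big -[RHS](sum_delta_r (fun m => rhit (l i k) b * u k m)).
apply: eq_bigr => m _; rewrite -mulr_suml scalerAl; congr (_ * _).
rewrite -(lhit_eps _ (rrow_LminusE m j)) lhit_sum.
by apply: eq_bigr => p _; rewrite lhit_conv.
Qed.

(** The product of [Rhat] with the proposed inverse is [rrow_LminusE] evaluated at a matrix element;
    for square matrices a right inverse is the inverse. *)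
Lemma Rhat_invE i j k m : Rhat_inv r u i j k m = l i m (u j k).
Proof.
pose Q : 'M[K]_#|{: 'I_n.+1 * 'I_n.+1}| := \matrix_(p, q)
  let: (i, j) := enum_val p in let: (k, m) := enum_val q in l i m (u j k).
have RQ : Rhat r u *m Q = 1%:M.
  apply/matrixP => p q; rewrite !mxE.
  have -> : (p == q) = (enum_val p == enum_val q).
    by apply/eqP/eqP => [->|/enum_val_inj].
  case Ep : (enum_val p) => [j' i']; case Eq : (enum_val q) => [k' m'].
  transitivity (\sum_(ab : 'I_n.+1 * 'I_n.+1)
      rrow i' ab.1 (u j' ab.2) * l ab.1 m' (u ab.2 k')).
    rewrite (reindex (@enum_val _ (mem {: 'I_n.+1 * 'I_n.+1}))) /=; last first.
      by apply: onW_bij; apply: enum_val_bij.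
    apply: eq_bigr => s _; rewrite !mxE Ep Eq.
    by case: (enum_val s).
  rewrite -(pair_bigA _ (fun s t : 'I_n.+1 => rrow i' s (u j' t) * l s m' (u t k'))) /=.
  have := rrow_LminusE i' m' (u j' k'); rewrite uc.2 => h.
  transitivity ((i' == m')%:R * (j' == k')%:R : K); last first.
    by rewrite -natrM mulnb xpair_eqE andbC.
  rewrite -h; apply: eq_bigr => a _.
  by apply/esym; apply: (@sw_corep _ _ _ _ uc K^o); lin.
have := mulmx1_unit RQ => -[Ru _].
have -> : Rhat_inv r u i j k m = Q (enum_rank (i, j)) (enum_rank (k, m)).
  by rewrite /Rhat_inv -[Q]mul1mx -(mulVmx Ru) -mulmxA RQ mulmx1.
by rewrite mxE !enum_rankK.
Qed.

End LFunctionals.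

(** * The calculus on A *)

Section FodcTheory.
Variables (K : fieldType) (X : algType K) (G : fodc X).
Implicit Types (a b : X) (g : G).

Local Notation "a *< g" := (lact G a g) (at level 40, left associativity).
Local Notation "g >* a" := (ract G g a) (at level 40, left associativity).
Local Notation d := (diff G).

Lemma lact1 g : 1 *< g = g. Proof. by case: (fodc_bimodule G). Qed.
Lemma lactM a b g : (a * b) *< g = a *< (b *< g).
Proof. by case: (fodc_bimodule G). Qed.
Lemma lact_ract a g b : a *< (g >* b) = (a *< g) >* b.
Proof. by case: (fodc_bimodule G). Qed.

Lemma ract1 g : g >* 1 = g. Proof. by case: (fodc_bimodule G). Qed.
Lemma ractM g a b : g >* (a * b) = (g >* a) >* b.
Proof. by case: (fodc_bimodule G). Qed.

Lemma lact_suml (I : finType) (f : I -> X) g :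
  (\sum_i f i) *< g = \sum_i f i *< g.
Proof. by apply: (linear_map_sum (f := fun a => a *< g)); lin. Qed.

Lemma lact_sumr a (I : finType) (f : I -> G) :
  a *< (\sum_i f i) = \sum_i a *< f i.
Proof. by apply: (linear_map_sum (f := fun g => a *< g)); lin. Qed.

Lemma ract_suml (I : finType) (f : I -> G) a :
  (\sum_i f i) >* a = \sum_i f i >* a.
Proof. by apply: (linear_map_sum (f := fun g => g >* a)); lin. Qed.

Lemma diff1 : d 1 = 0.
Proof.
have := diffM G 1 1; rewrite mulr1 lact1 => /eqP.
rewrite -subr_eq0 opprD addrA subrr add0r oppr_eq0 => /eqP.
by rewrite ract1.
Qed.

End FodcTheory.

(** * The tangent functionals, their product rule and the relations in Γ *)

Section TangentFunctionals.
Variables (K : fieldType) (A : hopfAlgType K) (r : universal_r_form A).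
Variables (n : nat) (u : 'M[A]_n.+1).
Hypothesis uc : matrix_corepresentation u.
Hypothesis ha : forall m : 'I_n.+1, (m < (ord_max : 'I_n.+1))%N ->
  Lminus r u m ord_max = 0.
Hypothesis hb : forall i j : 'I_n.+1, i != j ->
  Lminus r u ord_max i (u j ord_max) = 0.
Hypothesis hc_neq0 : alpha r u != 0.
Hypothesis hc : forall i : 'I_n.+1, i != ord_max ->
  conv (Lminus r u ord_max i) (Lminus r u ord_max ord_max) (u i ord_max) =
  alpha r u.
Implicit Types (a b : A) (i j k m : 'I_n.+1).

Local Notation N := (ord_max : 'I_n.+1).
Local Notation l := (Lminus r u).
Local Notation lam := (l N N).
Local Notation X := (tangent_basis r u).

Definition Lconv i j : A -> K^o := conv (l i j) lam.

Lemma Lconv_linear i j : linear (Lconv i j).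
Proof. by apply: conv_linear; apply: Lminus_linear. Qed.

Lemma tangent_basis_linear i : linear (X i).
Proof.
rewrite /tangent_basis; case: (i == ord_max).
  apply: (linear_kmul_r _ (linear_addf (Lconv_linear N N) _)).
  exact: (linear_oppf (@linear_scalar_comp _ _ _ counit _ (@linear_id _ _))).
exact: (linear_kmul_r _ (Lconv_linear N i)).
Qed.

Lemma Lminus_max m : m != N -> l m N = 0.
Proof.
move=> mN; apply: ha; rewrite ltn_neqAle leq_ord andbT.
by apply: contra mN => /eqP h; apply/eqP/val_inj.
Qed.

Lemma LminusM_max a b : lam (a * b) = lam a * lam b.
Proof.
rewrite (LminusM r uc) (bigD1 N) //= big1 ?addr0 // => k kN.
by rewrite (Lminus_max kN) mulr0.
Qed.

Lemma LconvM i j a b : Lconv i j (a * b) = \sum_k Lconv i k a * Lconv k j b.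
Proof.
have hl k m : linear (l k m) by apply: Lminus_linear.
rewrite /Lconv /conv (@sw_comulM _ _ K^o); last by lin.
under eq_bigr do rewrite /tlift /tens_eval big_distrlr /=.
rewrite exchange_big; apply: eq_bigr => p _.
rewrite exchange_big; apply: eq_bigr => q _.
rewrite (LminusM r uc) LminusM_max mulr_suml; apply: eq_bigr => k _.
by rewrite mulrACA.
Qed.

(** The Kronecker term absorbs the shift by ε in $X_N$, so that the last row of F treats all indices
    alike. *)
Lemma Lconv_maxE j a :
  Lconv N j a = alpha r u * X j a + (j == N)%:R * counit a.
Proof.
rewrite /tangent_basis; case: eqP => [->|_]; rewrite mulVKf //.
  by rewrite mul1r subrK.
by rewrite mul0r addr0.
Qed.

(** By (b), only the index N survives in the coproduct of $u^m_N$, so $F^N_k(x_m)$ is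
    $l^{-N}_k(x_m)$ times lam(x_N). This vanishes off the diagonal by (b); on the diagonal, (c) and
    the definition of α normalise the value to 1. *)
Lemma tangent_basis_coord i j : X i (u j N) = (i == j)%:R.
Proof.
have hE k m : conv (l N k) lam (u m N) = l N k (u m N) * lam (u N N).
  transitivity (\sum_p l N k (u m p) * lam (u p N)).
    have hl := Lminus_linear r u.
    by apply: (@sw_corep _ _ _ _ uc K^o); lin.
  rewrite (bigD1 N) //= big1 ?addr0 // => p pN.
  by rewrite hb ?mulr0 // eq_sym.
rewrite /tangent_basis /lrow; have [->|ij] := eqVneq i j.
  case: eqP => [->|/eqP jN]; last by rewrite hc // mulVf.
  by rewrite uc.2 eqxx -[_ - _]/(alpha r u) mulVf.
case: eqP => [iN|_]; last by rewrite hE hb // mul0r mulr0.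
have jN : N != j by rewrite -iN.
by rewrite hE hb // mul0r uc.2 eq_sym (negPf jN) subr0 mulr0.
Qed.

Lemma lhit_Lconv_max k a :
  lhit (Lconv N k) a = alpha r u *: lhit (X k) a + (k == N)%:R *: a.
Proof.
rewrite -[in X in _ = _ + X](lhit_counit a) /lhit !sw_scaler.
rewrite /tlift /tens_eval -big_split; apply: eq_bigr => p _ /=.
by rewrite Lconv_maxE scalerDl !scalerA.
Qed.

(** Expand the action of $F^N_i$ on ab by multiplicativity of F and by [Lconv_maxE], then cancel
    $\delta_{iN}\,ab$ and the factor α. *)
Lemma lhit_tangent_basisM i a b : lhit (X i) (a * b) =
  a * lhit (X i) b + \sum_k lhit (X k) a * lhit (Lconv k i) b.
Proof.
have := lhit_mul a b (Lconv_linear N i) (LconvM N i).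
under eq_bigr do rewrite lhit_Lconv_max mulrDl -!scalerAl.
rewrite big_split /= sum_delta_r !lhit_Lconv_max -scaler_sumr mulrDr -!scalerAr.
rewrite addrA => /addIr; rewrite -scalerDr => /(scalerI hc_neq0) ->.
by rewrite addrC.
Qed.

Lemma lhit_Lconv k j b : lhit (Lconv k j) b = lhit (l k j) (lhit lam b).
Proof. by rewrite lhit_conv //; apply: Lminus_linear. Qed.

Section Calculus.
Variables (G : fodc A) (T : set (A -> K^o)).
Hypothesis TE : T = tangent_functionals G.
Hypothesis TX : T = linear_span [set f | exists i, f = X i].
Implicit Types g : G.

Local Notation "a *< g" := (lact G a g) (at level 40, left associativity).
Local Notation "g >* a" := (ract G g a) (at level 40, left associativity).
Local Notation d := (diff G).
Local Notation om := (omega G).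
Local Notation th i := (om (u i N)).

Lemma omega_linear : linear om.
Proof. by apply: linear_sw_arg; lin. Qed.

Lemma omega1 : om 1 = 0.
Proof. by rewrite /omega comul1 sw_pure; [rewrite diff1 linear0r | lin]. Qed.

(** Insert $\varepsilon(a_{(1)}) = a_{(1)}S(a_{(2)})$ in front of da. *)
Lemma diff_omega a : d a = \sw_(x, y <- comul a) x *< om y.
Proof.
rewrite -[LHS](@sw_counitl _ _ _ d); last exact: linear_of.
transitivity (\sw_(x, z <- comul a) \sw_(x1, x2 <- comul x)
                (x1 * antipode x2) *< d z).
  apply: eq_sw => x y; rewrite -[in LHS](lact1 (d y)) -linearZl_LR -antipoder.
  by rewrite (linear_sw (f := fun c => c *< d y)) //; lin.
rewrite coassoc; try by move=> *; lin.
apply: eq_sw => x y; rewrite (linear_sw (f := fun g => x *< g)); last by lin.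
by apply: eq_sw => y1 y2; rewrite lactM.
Qed.

(** Otherwise some linear functional f has f(ω(b)) = 1. Then f ∘ ω is a tangent functional, hence a
    combination of the $X_i$, and so vanishes at b. *)
Lemma omega_eq0 b : counit b = 0 -> (forall i, X i b = 0) -> om b = 0.
Proof.
move=> eb Xb; apply/eqP; apply: contraT => /functional_neq0[f fb].
have fT : T (fun a => f (om a)).
  rewrite TE; split; last by move=> a _ ->; rewrite linear0.
    by move=> c a a'; rewrite omega_linear linearP.
  by rewrite omega1 linear0.
rewrite TX in fT.
have h v : linear_span [set f | exists i, f = X i] v -> v b = 0.
  apply: (linear_span_ind (P := fun v => v b = 0)) => // c v' w [i ->] wb.
  by rewrite -[_ = _]/(c * X i b + w b = 0) Xb wb mulr0 addr0.
by have := h _ fT; rewrite /= fb => /eqP; rewrite oner_eq0.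
Qed.

Lemma tangent_basis1 i : X i 1 = 0.
Proof.
have : T (X i) by rewrite TX; apply: linear_span_sub; exists i.
by rewrite TE => -[].
Qed.

Lemma omegaE a : om a = \sum_i (X i a : K) *: th i.
Proof.
have omN x y : om (x - y) = om x - om y by apply: linear_mapB omega_linear.
have XN j x y : X j (x - y) = X j x - X j y.
  exact: linear_mapB (tangent_basis_linear j).
(* The coordinates are shifted into the kernel of ε, where they stay dual to the $X_j$ and keep
   their ω. Subtracting from a its part along 1 and the v_i leaves an element to which [omega_eq0]
   applies. *)
pose v i := u i N - (i == N)%:R%:A.
have omv i : om (v i) = th i.
  by rewrite omN (linear_mapZ _ _ omega_linear) omega1 scaler0 subr0.
have Xv j i : X j (v i) = (j == i)%:R.
  rewrite XN (linear_mapZ _ _ (tangent_basis_linear j)) tangent_basis1 scaler0.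
  by rewrite subr0 tangent_basis_coord.
have ev i : counit (v i) = 0.
  by rewrite linearB linearZ /= counit1 uc.2 mulr1 subrr.
pose b := a - counit a *: 1 - \sum_i (X i a : K) *: v i.
have : om b = 0.
  apply: omega_eq0 => [|j].
    rewrite !linearB linearZ /= counit1 mulr1 subrr sub0r linear_sum big1 ?oppr0 //.
    by move=> i _; rewrite linearZ /= ev mulr0.
  rewrite !XN (linear_mapZ _ _ (tangent_basis_linear j)) tangent_basis1 scaler0.
  rewrite subr0 (linear_map_sum _ _ _ (tangent_basis_linear j)).
  apply/eqP; rewrite subr_eq0; apply/eqP.
  rewrite (bigD1 j) //= big1 ?addr0 => [|i ij].
    by rewrite (linear_mapZ _ _ (tangent_basis_linear j)) Xv eqxx /GRing.scale /= mulr1.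
  by rewrite (linear_mapZ _ _ (tangent_basis_linear j)) Xv eq_sym (negPf ij) scaler0.
rewrite !omN (linear_mapZ _ _ omega_linear) omega1 scaler0 subr0.
rewrite (linear_map_sum _ _ _ omega_linear) => /eqP; rewrite subr_eq0 => /eqP ->.
by apply: eq_bigr => i _; rewrite (linear_mapZ _ _ omega_linear) omv.
Qed.

Lemma diffE a : d a = \sum_i lhit (X i) a *< th i.
Proof.
rewrite diff_omega.
transitivity (\sum_i \sw_(x, y <- comul a) ((X i y : K) *: x) *< th i).
  rewrite -sw_sumr; apply: eq_sw => x y; rewrite omegaE lact_sumr.
  by apply: eq_bigr => i _; rewrite linearZl_LR linearZr_LR.
apply: eq_bigr => i _; rewrite /lhit (linear_sw (f := fun c => c *< th i)) //.
by lin.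
Qed.

Lemma diff_coordE i : d (u i N) = \sum_k u i k *< th k.
Proof.
rewrite diffE; apply: eq_bigr => k _; congr (_ *< _).
rewrite (lhit_corep uc); last exact: tangent_basis_linear.
rewrite -[RHS](sum_delta (u i)); apply: eq_bigr => m _.
by rewrite tangent_basis_coord.
Qed.

Lemma omega_coordE i : th i = \sum_k antipode (u i k) *< d (u k N).
Proof. by rewrite /omega (sw_corep uc) //; lin. Qed.

(** Expand d(ab) by [diffE] and the twisted product rule; the terms of a·db cancel against the
    Leibniz rule. *)
Lemma diff_ract a b : d a >* b =
  \sum_i (\sum_k lhit (X k) a * lhit (Lconv k i) b) *< th i.
Proof.
have := diffM G a b; rewrite [d (a * b)]diffE [d b]diffE lact_sumr.
under eq_bigr do rewrite lhit_tangent_basisM linearDl lactM.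
by rewrite big_split => /addrI <-.
Qed.

Lemma diff_coord_ractE i b : d (u i N) >* b =
  \sum_j (\sum_k u i k * lhit (Lconv k j) b) *< th j.
Proof.
rewrite diff_ract; apply: eq_bigr => j _; congr (_ *< _).
apply: eq_bigr => k _; congr (_ * _).
rewrite (lhit_corep uc); last exact: tangent_basis_linear.
rewrite -[RHS](sum_delta (u i)); apply: eq_bigr => m _.
by rewrite tangent_basis_coord.
Qed.

(** Write θ_j as Σ_k S(u^j_k) dx_k and use the formula for dx_k·b; the antipode then cancels the
    matrix u. *)
Lemma omega_ract j b : th j >* b = \sum_i lhit (Lconv j i) b *< th i.
Proof.
rewrite [in LHS]omega_coordE ract_suml.
under eq_bigr do rewrite -lact_ract diff_coord_ractE lact_sumr.
rewrite exchange_big; apply: eq_bigr => i _.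
under eq_bigr do rewrite -lactM.
rewrite -lact_suml; congr (_ *< _).
under eq_bigr do rewrite mulr_sumr.
rewrite exchange_big /= -[RHS](sum_delta (fun k => lhit (Lconv k i) b)).
apply: eq_bigr => k _; under eq_bigr do rewrite mulrA.
by rewrite -mulr_suml (corep_antipodel uc) -scalerAl mul1r.
Qed.

(** In [omega_ract] for j = N, the coefficients are α $X_i$ plus a Kronecker term: these two pieces
    sum to α db and b θ_N. *)
Lemma diff_theta b :
  d b = (alpha r u)^-1 *: (theta u G >* b - b *< theta u G).
Proof.
apply: (scalerI hc_neq0); rewrite scalerA mulfV // scale1r.
rewrite /theta omega_ract; apply/eqP; rewrite eq_sym subr_eq; apply/eqP.
under eq_bigr do rewrite lhit_Lconv_max linearDl /= !linearZl_LR.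
by rewrite big_split /= sum_delta_r -scaler_sumr -diffE.
Qed.

Lemma diff_coord_ract i b :
  d (u i N) >* b = \sum_m rhit (l i m) (lhit lam b) *< d (u m N).
Proof.
rewrite diff_coord_ractE.
under eq_bigr => j _ do under eq_bigr => k _ do rewrite lhit_Lconv.
under eq_bigr do rewrite (rform_inv_commE r uc) lact_suml.
rewrite exchange_big; apply: eq_bigr => m _; rewrite diff_coordE lact_sumr.
by apply: eq_bigr => k _; rewrite lactM.
Qed.

Lemma diff_coord_ract_coord i j : d (u i N) >* u j N =
  lam (u N N) *:
    \sum_k \sum_m Rhat_inv r u i j k m *: (u k N *< d (u m N)).
Proof.
rewrite diff_coord_ract exchange_big scaler_sumr; apply: eq_bigr => m _.
(* By (b) each coordinate is an eigenvector of lam, which produces the scalar in front of the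
   sum. *)
have -> : lhit lam (u j N) = (lam (u N N) : K) *: u j N.
  rewrite (lhit_corep uc); last exact: Lminus_linear.
  rewrite (bigD1 N) //= big1 ?addr0 // => k kN.
  by rewrite hb 1?eq_sym // scale0r.
rewrite (linear_mapZ _ _ (rhit_linear (Lminus_linear r u i m))) linearZl_LR.
congr (_ *: _); rewrite /rhit (sw_corep uc); last first.
  by have hl := Lminus_linear r u; lin.
rewrite lact_suml; apply: eq_bigr => k _.
by rewrite linearZl_LR (Rhat_invE r uc).
Qed.

End Calculus.
End TangentFunctionals.

(** * Left covariance and freeness *)

Section TensorActions.
Variables (K : fieldType) (A : hopfAlgType K).

Lemma tmap_linear (U U' V V' : lmodType K) (f : {linear U -> U'})
  (g : {linear V -> V'}) : linear (tmap f g).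
Proof. by apply: sw_bilinear; lin. Qed.

Lemma tmap_id (V W : lmodType K) (t : tensor V W) : tmap idfun idfun t = t.
Proof. by rewrite [RHS]tensorE. Qed.

Lemma tmap_comp (U V V' V'' : lmodType K) (f : {linear V -> V'})
    (g : {linear V' -> V''}) (t : tensor U V) :
  tmap idfun g (tmap idfun f t) = tmap idfun (g \o f) t.
Proof. by rewrite /tmap sw_tmap //; lin. Qed.

Lemma tmap_retract (U V W : lmodType K) (f : W -> V) (g : {linear V -> W})
    (t : tensor U W) : cancel f g -> tmap idfun g (tmap idfun f t) = t.
Proof.
move=> fK; rewrite [LHS]/tmap sw_tmap; last by lin.
by rewrite [RHS]tensorE; apply: eq_sw => x y; rewrite fK.
Qed.

Lemma tmap_tmul (X C : algType K) (f : {lrmorphism X -> C}) (s t : tensor A X) :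
  tmap idfun f (tmul s t) = tmul (tmap idfun f s) (tmap idfun f t).
Proof.
rewrite /tmul (linear_sw _ _ (tmap_linear _ _)) sw_tmap; last by lin.
apply: eq_sw => a b; rewrite (linear_sw _ _ (tmap_linear _ _)) sw_tmap; last by lin.
by apply: eq_sw => a' b'; rewrite /tmap sw_pure /= ?rmorphM //; lin.
Qed.

Section Action.
Variables (X : algType K) (G : fodc X).

Lemma tact_bilin : bilin (@tact K A X G).
Proof.
split=> t; rewrite /tact.
  by apply: sw_bilinear; lin.
by apply: linear_swf => a b; apply: sw_bilinear; lin.
Qed.

Lemma tact_pure a x (t : tensor A G) :
  tact (a ⊗ x) t = \sw_(b, g <- t) (a * b) ⊗ lact G x g.
Proof. by rewrite /tact sw_pure //; lin. Qed.

Lemma tactM (s s' : tensor A X) (t : tensor A G) :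
  tact (tmul s s') t = tact s (tact s' t).
Proof.
have [hl hr] := tact_bilin.
rewrite /tmul (linear_sw _ _ (hl t)) [RHS]/tact; apply: eq_sw => a x.
rewrite (linear_sw _ _ (hl t)) -tact_pure [tact s' t]/tact (linear_sw _ _ (hr _)).
apply: eq_sw => a' x'; rewrite [LHS]tact_pure (linear_sw _ _ (hr _)).
apply: eq_sw => b g; rewrite tact_pure sw_pure; last by lin.
by rewrite mulrA lactM.
Qed.

Lemma tact1 (t : tensor A G) : tact (1 ⊗ 1) t = t.
Proof.
by rewrite tact_pure [RHS]tensorE; apply: eq_sw => b g; rewrite mul1r lact1.
Qed.

End Action.
End TensorActions.

Section Covariance.
Variables (K : fieldType) (A : hopfAlgType K) (G : fodc A).
Variable Phi : {linear G -> tensor A G}.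
Hypothesis Phi_cov : left_coaction idfun Phi.

Local Notation "a *< g" := (lact G a g) (at level 40, left associativity).
Local Notation "g >* a" := (ract G g a) (at level 40, left associativity).
Local Notation d := (diff G).

(** For the identity embedding, the lift of the coproduct required by [left_coaction] can only be
    [comul]. *)
Lemma coaction_diff a b :
  Phi (a *< d b) = tact (comul a) (tmap idfun d (comul b)).
Proof.
have [delta hd ->] := Phi_cov.
have dE x : delta x = comul x by rewrite -[LHS]tmap_id hd.
by rewrite !dE.
Qed.

(** By the Leibniz rule, a·db·e = a·d(be) - ab·de. *)
Lemma forms_span_left g : linear_span [set h | exists a b, h = a *< d b] g.
Proof.
apply: (linear_span_ind _ _ (forms_span g)); first exact: linear_span0.
move=> c v w [a [b [e ->]]] hw; apply: linear_spanP => //.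
have -> : a *< (d b >* e) = (-1) *: ((a * b) *< d e) + a *< d (b * e).
  rewrite diffM linearDr lactM scaleN1r.
  by rewrite addrA addNr add0r.
by apply: linear_spanP; apply: linear_span_sub; do 2!eexists.
Qed.

Lemma coaction_lact a g : Phi (a *< g) = tact (comul a) (Phi g).
Proof.
have [hl hr] := tact_bilin A G.
apply: (linear_span_ind (P := fun g => Phi (a *< g) = tact (comul a) (Phi g))
  _ _ (forms_span_left g)).
  by rewrite linear0r linear0 (linear_map0 (hr _)).
move=> c v w [b [e ->]] hw; rewrite linearPr !linearP hr -hw.
by rewrite -lactM !coaction_diff comulM tactM.
Qed.

(** Φ(du^k_j) equals Σ_m Δ(u^k_m)(1 ⊗ ω(u^m_j)). Multiplying by Δ(S(u^i_k)) and summing over k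
    leaves Δ of Σ_k S(u^i_k)u^k_m = δ_im, so the coproduct of an antipode is never computed. *)
Lemma coaction_omega_corep n (u : 'M[A]_n) i j :
  matrix_corepresentation u ->
  (forall i, d (u i j) = \sum_k u i k *< omega G (u k j)) ->
  Phi (omega G (u i j)) = 1 ⊗ omega G (u i j).
Proof.
move=> uc hd; have [hl hr] := tact_bilin A G.
have hth m : omega G (u m j) = \sum_k antipode (u m k) *< d (u k j).
  by rewrite /omega (sw_corep uc) //; lin.
rewrite [in LHS]hth linear_sum.
transitivity (\sum_k \sum_m
   tact (comul (antipode (u i k) * u k m)) (1 ⊗ omega G (u m j))).
  apply: eq_bigr => k _; rewrite coaction_lact.
  have -> : Phi (d (u k j)) = \sum_m tact (comul (u k m)) (1 ⊗ omega G (u m j)).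
    rewrite -[d (u k j)](lact1 (d (u k j))) coaction_diff comul1 tact1 /tmap uc.1 sw_sum;
      last by lin.
    transitivity (\sum_p \sum_m u k p ⊗ (u p m *< omega G (u m j))).
      by apply: eq_bigr => p _; rewrite hd linear_sumr.
    rewrite exchange_big; apply: eq_bigr => m _.
    rewrite uc.1 (linear_map_sum _ _ _ (hl _)); apply: eq_bigr => p _.
    by rewrite tact_pure sw_pure ?mulr1 //; lin.
  rewrite (linear_map_sum _ _ _ (hr _)); apply: eq_bigr => m _.
  by rewrite comulM tactM.
rewrite exchange_big /=.
transitivity (\sum_m (i == m)%:R *: (1 ⊗ omega G (u m j) : tensor A G)).
  apply: eq_bigr => m _; rewrite -(linear_map_sum _ _ _ (hl _)) -linear_sum.
  rewrite (corep_antipodel uc) linearZ /= (linear_mapZ _ _ (hl _)).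
  by rewrite comul1 tact1.
exact: (sum_delta (fun m => 1 ⊗ omega G (u m j) : tensor A G)).
Qed.

(* The coefficient of [g] at a left-invariant form is recovered by applying   *)
(* $g \mapsto S(g_(-1)) g_(0)$, which sends $a \theta$ to $ε(a) \theta$, and  *)
(* a dual functional to the second factor of [Phi g].                         *)
Lemma left_invariant_free (I : finType) (t : I -> G) :
  (forall i, Phi (t i) = 1 ⊗ t i) ->
  (forall c : I -> K, \sum_i c i *: t i = 0 -> forall i, c i = 0) ->
  forall f : I -> A, \sum_i f i *< t i = 0 -> forall i, f i = 0.
Proof.
move=> tinv tfree f f0 j.
pose P (g : G) := \sw_(x, h <- Phi g) antipode x *< h.
have Plin : linear P by apply: linear_sw_arg; lin.
have Phit a i : Phi (a *< t i) = \sw_(x, y <- comul a) x ⊗ (y *< t i).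
  rewrite coaction_lact tinv /tact; apply: eq_sw => x y.
  by rewrite sw_pure ?mulr1 //; lin.
have Pt a i : P (a *< t i) = counit a *: t i.
  rewrite /P Phit (linear_sw _ _ (sw_bilinear _)); last by lin.
  transitivity (\sw_(x, y <- comul a) (antipode x * y) *< t i).
    by apply: eq_sw => x y; rewrite sw_pure ?lactM //; lin.
  rewrite -(linear_sw (f := fun c => c *< t i)); last by lin.
  by rewrite antipodel linearZl_LR lact1.
have [e he] := dual_functionals tfree j.
pose C (g : G) := \sw_(x, h <- Phi g) (e (P h) : K) *: x.
have Cb : bilin (fun x h => (e (P h) : K) *: x : A) by lin.
have Clin : linear C by apply: linear_sw_arg; lin.
have Ct a i : C (a *< t i) = (i == j)%:R *: a.
  rewrite /C Phit (linear_sw _ _ (sw_bilinear Cb)) -[in RHS](counitr a) sw_scaler.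
  apply: eq_sw => x y; rewrite sw_pure // Pt linearZ /= he scalerA.
  by rewrite /GRing.scale /= mulrC.
have := linear_map_sum (index_enum I) xpredT (fun i => f i *< t i) Clin.
rewrite f0 => h.
rewrite -(sum_delta_r f j) -[RHS](linear_map0 Clin) h.
by apply: eq_bigr => i _; rewrite Ct.
Qed.

End Covariance.

(** * The induced calculus on the coordinate algebra *)

Lemma subalg_type_ind (K : fieldType) (A : algType K) (S : set A)
    (Q : subalg_type S -> Prop) :
  Q 1 -> (forall c x y, Q x -> Q y -> Q (c *: x + y)) ->
  (forall x y, Q x -> Q y -> Q (x * y)) ->
  (forall x, S (subalg_incl x) -> Q x) -> forall x, Q x.
Proof.
move=> Q1 QP QM QS x.
(* [Q] is a property of the subtype; the underlying elements of its members form a subalgebra of A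
   containing [S]. *)
pose B : {pred A} := fun a => `[< exists y, subalg_incl y = a /\ Q y >].
have cB : subalg_closed B.
  split.
  - by apply/asboolP; exists 1; rewrite rmorph1.
  - move=> c a b /asboolP[y [<- Qy]] /asboolP[z [<- Qz]]; apply/asboolP.
    by exists (c *: y + z); rewrite linearP; split=> //; apply: QP.
  - move=> a b /asboolP[y [<- Qy]] /asboolP[z [<- Qz]]; apply/asboolP.
    by exists (y * z); rewrite rmorphM; split=> //; apply: QM.
have SB s : S s -> s \in B.
  move=> Ss; apply/asboolP; exists (Sub s (mem_subalg Ss)).
  by rewrite /subalg_incl SubK; split=> //; apply: QS; rewrite /subalg_incl SubK.
case: (x) => a aS; have /asboolP/(_ B cB SB)/asboolP[y [ya Qy]] := aS.
by rewrite (_ : exist _ a aS = y) //; apply: val_inj.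
Qed.

(** Elements whose coproduct comes from A ⊗ X form a subalgebra, so generators suffice. A linear
    retraction p of A onto X makes the choice of lifts linear: take (id ⊗ p)Δ. *)
Lemma subalg_comul (K : fieldType) (A : hopfAlgType K) (S : set A) :
  (forall s, S s -> exists t : tensor A (subalg_type S),
     tmap idfun (@subalg_incl _ _ S) t = comul s) ->
  exists delta : {linear subalg_type S -> tensor A (subalg_type S)},
    forall x, tmap idfun (@subalg_incl _ _ S) (delta x) = comul (subalg_incl x).
Proof.
move=> Scomul; pose i : {lrmorphism subalg_type S -> A} := @subalg_incl K A S.
have im x : exists t, tmap idfun i t = comul (i x).
  elim/subalg_type_ind: x => [|c x y [s hs] [t ht]|x y [s hs] [t ht]|x /Scomul //].
  - by exists (1 ⊗ 1); rewrite rmorph1 comul1 /tmap sw_pure /= ?rmorph1 //; lin.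
  - by exists (c *: s + t); rewrite !linearP -hs -ht (tmap_linear idfun i).
  - by exists (tmul s t); rewrite rmorphM comulM -hs -ht (tmap_tmul i).
have [p pK] := @linear_retraction _ _ _ (i : {linear _ -> _}) val_inj.
have dl : linear (fun x => tmap idfun p (comul (i x))).
  by apply: (linear_comp (tmap_linear idfun p)); lin.
pose delta : {linear subalg_type S -> tensor A (subalg_type S)} :=
  HB.pack (fun x => tmap idfun p (comul (i x))) (GRing.isLinear.Build K _ _ _ _ dl).
exists delta => x /=.
have [t ht] := im x; by rewrite -ht (tmap_retract t pK).
Qed.

(* The coproduct of A and the coaction of G are corestricted by means of      *)
(* linear retractions onto the subalgebra and the space of induced forms.     *)
Lemma induced_left_covariant (K : fieldType) (A : hopfAlgType K) (S : set A)
    (G : fodc A) (Phi : {linear G -> tensor A G}) :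
  left_coaction idfun Phi ->
  (forall s, S s -> exists t : tensor A (subalg_type S),
     tmap idfun (@subalg_incl _ _ S) t = comul s) ->
  left_covariant (@subalg_incl _ _ S)
    (induced_fodc (@subalg_incl _ _ S : {lrmorphism _ -> _}) G).
Proof.
move=> Phi_cov Scomul; have [delta hdelta] := subalg_comul Scomul.
pose i : {lrmorphism subalg_type S -> A} := @subalg_incl K A S.
pose H := induced_fodc i G.
pose v : {linear H -> G} := (\val : induced_forms i G -> G).
have [q qK] := @linear_retraction _ _ _ v val_inj.
have Pl : linear (fun g : H => tmap idfun q (Phi (v g))).
  by apply: (linear_comp (tmap_linear idfun q)); lin.
pose Psi : {linear H -> tensor A H} :=
  HB.pack (fun g : H => tmap idfun q (Phi (v g))) (GRing.isLinear.Build K _ _ _ _ Pl).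
exists Psi, delta => // x y.
transitivity (tmap idfun q (Phi (lact G (i x) (diff G (i y))))); first by [].
rewrite (coaction_diff Phi_cov) -!hdelta.
have -> : tmap idfun (diff G) (tmap idfun (@subalg_incl _ _ S) (delta y)) =
          tmap idfun v (tmap idfun (diff H) (delta y)).
  by rewrite !tmap_comp.
have -> s t : tact (tmap idfun i s) (tmap idfun v t) = tmap idfun v (tact s t).
  rewrite /tact sw_tmap; last by lin.
  rewrite (linear_sw _ _ (tmap_linear idfun v)); apply: eq_sw => a b.
  rewrite sw_tmap; last by lin.
  rewrite (linear_sw _ _ (tmap_linear idfun v)); apply: eq_sw => a' g.
  by rewrite /tmap sw_pure //; lin.
exact: tmap_retract.
Qed.

(** * Freeness and commutation relations over the coordinate algebra *)

Section CoordinateCalculus.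
Variables (K : fieldType) (A : hopfAlgType K) (r : universal_r_form A).
Variables (n : nat) (u : 'M[A]_n.+1).
Hypothesis uc : matrix_corepresentation u.
Hypothesis ha : forall m : 'I_n.+1, (m < (ord_max : 'I_n.+1))%N ->
  Lminus r u m ord_max = 0.
Hypothesis hb : forall i j : 'I_n.+1, i != j ->
  Lminus r u ord_max i (u j ord_max) = 0.
Hypothesis hc_neq0 : alpha r u != 0.
Hypothesis hc : forall i : 'I_n.+1, i != ord_max ->
  conv (Lminus r u ord_max i) (Lminus r u ord_max ord_max) (u i ord_max) =
  alpha r u.
Variables (G : fodc A) (Phi : {linear G -> tensor A G}).
Hypothesis Phi_cov : left_coaction idfun Phi.
Hypothesis G_tangent : is_quantum_tangent_space Phi
  (linear_span [set f | exists i, f = tangent_basis r u i]).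

Local Notation N := (ord_max : 'I_n.+1).
Local Notation l := (Lminus r u).
Local Notation CX := (coord_algebra u).
Local Notation H := (coord_fodc u G).
Local Notation dx := (dcoord u G).

Let TE := G_tangent.2.

Lemma coord_ind (Q : CX -> Prop) :
  Q 1 -> (forall c x y, Q x -> Q y -> Q (c *: x + y)) ->
  (forall x y, Q x -> Q y -> Q (x * y)) ->
  (forall i, Q (Defs.coord u i)) -> forall x, Q x.
Proof.
move=> Q1 QP QM QC; apply: subalg_type_ind => // x [i xi].
by rewrite (_ : x = Defs.coord u i) //; apply: val_inj.
Qed.

Lemma coord_left_covariant : left_covariant (coord_incl u) H.
Proof.
apply: (induced_left_covariant Phi_cov) => s [i ->].
exists (\sum_k u i k ⊗ Defs.coord u k); rewrite /tmap sw_sum; last by lin.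
by rewrite uc.1.
Qed.

(** The relation says ω(a) = 0 for a = Σ c_i x_i. The tangent functional $X_j$ therefore kills a -
    ε(a)1, while by duality its value there is c_j. *)
Lemma omega_free_scalar (c : 'I_n.+1 -> K) :
  \sum_i c i *: omega G (u i N) = 0 -> forall i, c i = 0.
Proof.
move=> h j; pose a := \sum_i c i *: u i N.
have Xlin := tangent_basis_linear r u j.
have oma : omega G a = 0.
  rewrite (linear_map_sum _ _ _ (omega_linear G)) -[RHS]h.
  by apply: eq_bigr => i _; rewrite (linear_mapZ _ _ (omega_linear G)).
have : tangent_functionals G (tangent_basis r u j).
  by rewrite -TE; apply: linear_span_sub; exists j.
case=> _ X1 /(_ (a - counit a *: 1)).
rewrite linearB linearZ /= counit1 mulr1 subrr => /(_ erefl).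
rewrite (linear_mapB _ _ (omega_linear G)) (linear_mapZ _ _ (omega_linear G)).
rewrite omega1 oma scaler0 subr0 => /(_ erefl).
rewrite (linear_mapB _ _ Xlin) (linear_mapZ _ _ Xlin) X1 scaler0 subr0.
rewrite (linear_map_sum _ _ _ Xlin) => Xa; rewrite -[RHS]Xa -[LHS](sum_delta (c : _ -> K^o) j).
apply: eq_bigr => i _; rewrite (linear_mapZ _ _ Xlin).
by rewrite (tangent_basis_coord uc hb hc_neq0 hc) /GRing.scale /= mulrC.
Qed.

Let dE := diff_coordE uc hb hc_neq0 hc TE erefl.
Let dR := diff_coord_ract uc ha hb hc_neq0 hc TE erefl.
Let dRc := diff_coord_ract_coord uc ha hb hc_neq0 hc TE erefl.

Lemma diff_coord_free (f : 'I_n.+1 -> A) :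
  \sum_i lact G (f i) (diff G (u i N)) = 0 -> forall i, f i = 0.
Proof.
move=> h; have tinv i := coaction_omega_corep Phi_cov i uc dE.
(* These sums are the coefficients at the invariant forms θ_k; the antipode then recovers f from
   them. *)
have fu k : \sum_i f i * u i k = 0.
  apply: (left_invariant_free Phi_cov tinv omega_free_scalar
            (f := fun k => \sum_i f i * u i k)).
  rewrite -[RHS]h; under eq_bigr do rewrite lact_suml.
  rewrite exchange_big; apply: eq_bigr => i _; rewrite dE lact_sumr.
  by apply: eq_bigr => m _; rewrite lactM.
move=> i; transitivity (\sum_k (\sum_j f j * u j k) * antipode (u k i)).
  under eq_bigr do rewrite mulr_suml.
  rewrite exchange_big /= -[LHS](sum_delta_r f i); apply: eq_bigr => j _.
  under eq_bigr do rewrite -mulrA.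
  by rewrite -mulr_sumr (corep_antipoder uc) -scalerAr mulr1.
by apply: big1 => k _; rewrite fu mul0r.
Qed.

Let vK : injective (forms_incl u G). Proof. exact: val_inj. Qed.

Let vlact x (g : H) :
  forms_incl u G (lact H x g) = lact G (coord_incl u x) (forms_incl u G g).
Proof. by []. Qed.
Let vract x (g : H) :
  forms_incl u G (ract H g x) = ract G (forms_incl u G g) (coord_incl u x).
Proof. by []. Qed.
Let vdx i : forms_incl u G (dx i) = diff G (u i N).
Proof. by []. Qed.

Lemma coord_quadratic : quadratic_relations r (@ract _ _ H).
Proof.
have vl := linear_of (forms_incl u G).
move=> i j; apply: vK; rewrite vract vdx [LHS]dRc (linear_mapZ _ _ vl).
congr (_ *: _); rewrite (linear_map_sum _ _ _ vl); apply: eq_bigr => k _.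
rewrite (linear_map_sum _ _ _ vl); apply: eq_bigr => m _.
by rewrite (linear_mapZ _ _ vl).
Qed.

Lemma coord_general : general_relations r (@ract _ _ H).
Proof.
move=> i x; rewrite vract vdx dR; apply: eq_bigr => m _; congr (lact G _ _).
rewrite /rhit comul_lhit; first last.
- by have hl := Lminus_linear r u; lin.
- exact: Lminus_linear.
apply: eq_sw => x1 y; rewrite /lhit sw_scaler.
by apply: eq_sw.
Qed.

Definition coord_span (g : H) : Prop := exists c : 'I_n.+1 -> CX,
  g = \sum_i lact H (c i) (dx i).

Lemma coord_span_lin c g h :
  coord_span g -> coord_span h -> coord_span (c *: g + h).
Proof.
move=> [f ->] [f' ->]; exists (fun i => c *: f i + f' i).
rewrite scaler_sumr -big_split; apply: eq_bigr => i _.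
by rewrite linearPl.
Qed.

Lemma coord_span_lact x g : coord_span g -> coord_span (lact H x g).
Proof.
move=> [f ->]; exists (fun i => x * f i); rewrite lact_sumr.
by apply: eq_bigr => i _; rewrite lactM.
Qed.

Lemma coord_span_sum (I : finType) (f : I -> H) :
  (forall i, coord_span (f i)) -> coord_span (\sum_i f i).
Proof.
move=> hf; elim/big_ind: _ => // [|g h hg hh].
  by exists (fun=> 0); rewrite big1 // => i _; rewrite linear0l.
by rewrite -[g]scale1r; apply: coord_span_lin.
Qed.

Lemma coord_span_scale c g : coord_span g -> coord_span (c *: g).
Proof.
move=> hg; rewrite -[_ *: _]addr0; apply: coord_span_lin => //.
(* The zero form is the empty sum. *)
by have := @coord_span_sum 'I_0 (fun=> 0); rewrite big_ord0; apply; case.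
Qed.

Lemma coord_span_dx i : coord_span (dx i).
Proof.
exists (fun k => (i == k)%:R *: 1).
by rewrite -[LHS](sum_delta dx); apply: eq_bigr => k _; rewrite linearZl_LR lact1.
Qed.

(** Induction on x as an element of the generated algebra: for a generator, the quadratic relations
    rewrite dx_i·x_j with coefficients on the left. *)
Lemma coord_span_ract g x : coord_span g -> coord_span (ract H g x).
Proof.
elim/coord_ind: x g => [|c x y hx hy|x y hx hy|j] g hg.
- by rewrite ract1.
- by rewrite linearPr; apply: coord_span_lin; [apply: hx | apply: hy].
- by rewrite ractM; apply/hy/hx.
have [f ->] := hg; rewrite ract_suml; apply: coord_span_sum => i.
rewrite -lact_ract; apply: coord_span_lact; rewrite coord_quadratic.
apply/coord_span_scale/coord_span_sum => k; apply: coord_span_sum => m.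
by apply/coord_span_scale/coord_span_lact/coord_span_dx.
Qed.

Lemma coord_spanT g : coord_span g.
Proof.
have hd x : coord_span (diff H x).
  elim/coord_ind: x => [|c x y hx hy|x y hx hy|i]; last exact: coord_span_dx.
  - have := @coord_span_sum 'I_0 (fun=> 0); rewrite big_ord0 => h0.
    by rewrite diff1; apply: h0; case.
  - by rewrite linearP; apply: coord_span_lin.
  - rewrite diffM -[lact _ _ _]scale1r; apply: coord_span_lin.
      exact: coord_span_lact.
    exact: coord_span_ract.
apply: (linear_span_ind (P := coord_span) _ _ (forms_span g)).
  by have := @coord_span_sum 'I_0 (fun=> 0); rewrite big_ord0; apply; case.
move=> c v w [x [y [z ->]]] hw; apply: coord_span_lin => //.
by apply/coord_span_lact/coord_span_ract.
Qed.

(** Uniqueness of the coefficients is inherited from independence over the larger algebra A. *)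
Lemma coord_free : free_left_basis dx.
Proof.
move=> g; have [f gE] := coord_spanT g; exists [ffun i => f i]; split.
  by rewrite gE; apply: eq_bigr => i _; rewrite ffunE.
move=> c cE; apply/ffunP => i; rewrite ffunE; apply: val_inj.
apply/eqP; rewrite -subr_eq0; apply/eqP.
apply: (diff_coord_free (f := fun i => coord_incl u (f i) - coord_incl u (c i))).
under eq_bigr do rewrite linearBl -!vdx -!vlact.
by rewrite sumrB -!linear_sum /= -gE -cE subrr.
Qed.

(** * The relations determine the right action *)

Section RightAction.
Variable rho : {bilinear H -> CX -> H}.
Hypothesis rho_bimod : is_bimodule (lact H) rho.

(** Both actions commute with the left one, and the dx_i generate the forms on the left, so
    agreement on the dx_i·x_j spreads to all forms and to products of coordinates. *)
Lemma quadratic_unique :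
  quadratic_relations r rho -> forall g x, rho g x = ract H g x.
Proof.
move=> hq g x; have [_ _ r1 rM lr] := rho_bimod.
elim/coord_ind: x g => [|c x y hx hy|x y hx hy|j] g.
- by rewrite r1 ract1.
- by rewrite !linearPr hx hy.
- by rewrite rM ractM hx hy.
have [f ->] := coord_spanT g.
rewrite ract_suml (linear_map_sum (f := fun g => rho g _)); last by lin.
by apply: eq_bigr => i _; rewrite -lr -lact_ract hq coord_quadratic.
Qed.

Lemma quadratic_general :
  quadratic_relations r rho <-> general_relations r rho.
Proof.
split=> h i x; first by rewrite (quadratic_unique h) coord_general.
(* The general relations give [rho] and the action of the calculus the same image in [G], where the
   forms embed. *)
rewrite -coord_quadratic; apply: vK.
by rewrite h coord_general.
Qed.

End RightAction.
End CoordinateCalculus.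

Theorem proposition2 (R : realType) (A : hopfAlgType R[i])
    (r : universal_r_form A) (n : nat) (u : 'M[A]_n.+1)
    (u_corep : matrix_corepresentation u)
    (ha : forall m : 'I_n.+1, (m < (ord_max : 'I_n.+1))%N ->
       Lminus r u m ord_max = 0)
    (hb : forall i j : 'I_n.+1, i != j ->
       Lminus r u ord_max i (u j ord_max) = 0)
    (hc_neq0 : alpha r u != 0)
    (hc : forall i : 'I_n.+1, i != ord_max ->
       conv (Lminus r u ord_max i) (Lminus r u ord_max ord_max) (u i ord_max) =
       alpha r u)
    (G : fodc A) (Phi : {linear G -> tensor A G})
    (G_covariant : left_coaction idfun Phi)
    (G_tangent : is_quantum_tangent_space Phi
       (linear_span [set f | exists i, f = tangent_basis r u i])) :
  [/\ left_covariant (coord_incl u) (coord_fodc u G),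
      free_left_basis (dcoord u G),
      quadratic_relations r (@ract _ _ (coord_fodc u G)) /\
      general_relations r (@ract _ _ (coord_fodc u G)),
      forall rho : {bilinear coord_fodc u G -> coord_algebra u -> coord_fodc u G},
        is_bimodule (lact (coord_fodc u G)) rho ->
        (quadratic_relations r rho <-> general_relations r rho) /\
        (quadratic_relations r rho ->
           forall g x, rho g x = ract (coord_fodc u G) g x) &
      forall x : coord_algebra u,
        diff G (coord_incl u x) =
        (alpha r u)^-1 *: (ract G (theta u G) (coord_incl u x) - lact G (coord_incl u x) (theta u G))].
Proof.
split.
- exact: (coord_left_covariant u_corep G_covariant).
- exact: (coord_free u_corep ha hb hc_neq0 hc G_covariant G_tangent).
- split.
    exact: (coord_quadratic u_corep ha hb hc_neq0 hc G_tangent).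
  exact: (coord_general u_corep ha hb hc_neq0 hc G_tangent).
- move=> rho rho_bimod; split.
    exact: (quadratic_general u_corep ha hb hc_neq0 hc G_tangent rho_bimod).
  exact: (quadratic_unique u_corep ha hb hc_neq0 hc G_tangent rho_bimod).
- move=> x.
  exact: (diff_theta u_corep ha hb hc_neq0 hc G_tangent.2 erefl).
Qed.
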